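(* The determinant of the square matrix over $\mathbb Z/2$ represented by a finite directed graph is not computable in $\tilde{C}$PTime. That is, no polynomial time bounded BGS program (without the cardinality function) decides, for every finite directed graph $\langle I,E\rangle$ with $E\subseteq I\times I$, whether the $I$-square matrix $M$ over $\mathbb Z/2$ with $M(i,j)=1\iff(i,j)\in E$ has determinant $1$.
   Context: The determinant of an $I$-square matrix $M:I\times I\to\mathbb Z/2$ is that of the ordinary matrix obtained by choosing any linear ordering of $I$ for both rows and columns (independent of the ordering). $\tilde{C}$PTime is the class of Boolean queries decidable by polynomial time bounded BGS programs: abstract state machine programs operating on the hereditarily finite sets over the input's elements (as atoms), with the input relations, logical operations, set functions $\in,\emptyset,$ Atoms, $\bigcup$, TheUnique, Pair, comprehension terms $\{t(v):v\in r:\varphi(v)\}$, dynamic functions updated by rules built from updates, conditionals and parallel ''do forall'' rules (all updates of a step executed simultaneously unless conflicting), run for at most polynomially many steps with at most polynomially many active elements in the input size; the answer is the value of Output when Halt first becomes true. *)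

(* Defs.v *)
From HB Require Import structures.
From mathcomp Require Import all_boot all_order all_fingroup all_algebra.
From Stdlib Require Import Relation_Operators.

Set Implicit Arguments.
Unset Strict Implicit.
Unset Printing Implicit Defensive.

Import GRing.Theory.

(** * Hereditarily finite sets over a finite set [I] of atoms

    A set is a finite tree whose leaves are atoms.  To make extensionality hold
    for Leibniz equality, only canonical trees are kept: the list of children of
    a node is strictly increasing for the enumeration [pickle] of all trees (and
    the label that [GenTree] puts on nodes is 0).  The order is only used for
    the representation; programs have no access to it. *)

Section HereditarilyFinite.
Variable I : finType.

Fixpoint canonical (t : GenTree.tree I) : bool :=
  match t with
  | GenTree.Leaf _ => true
  | GenTree.Node k ts =>
      [&& k == 0, all canonical ts & sorted ltn (map pickle ts)]
  end.

Record hf := Hf { hf_tree : GenTree.tree I; hf_canonical : canonical hf_tree }.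

HB.instance Definition _ := [isSub for hf_tree].
HB.instance Definition _ := [Countable of hf by <:].

Definition atom (a : I) : hf := @Hf (GenTree.Leaf a) isT.

Definition is_set (x : hf) : bool :=
  if val x is GenTree.Node _ _ then true else false.

(* Atoms have no elements. *)
Definition elems (x : hf) : seq hf :=
  if val x is GenTree.Node _ ts then pmap insub ts else [::].

Definition children_of (s : seq hf) : seq (GenTree.tree I) :=
  sort (relpre pickle leq) (undup (map val s)).

Lemma canonical_children_of s : canonical (GenTree.Node 0 (children_of s)).
Proof.
rewrite /= sorted_map; apply/andP; split.
  apply/allP => t; rewrite mem_sort mem_undup => /mapP[x _ ->].
  exact: hf_canonical.
have uc : uniq (children_of s) by rewrite sort_uniq undup_uniq.
have sc : sorted (relpre pickle leq) (children_of s).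
  by apply: sort_sorted => x y; apply: leq_total.
elim: (children_of s) uc sc => //= x [|y r] IH //= /andP[xr ur] /andP[xy yr].
have /= -> := IH ur yr; rewrite ltn_neqAle xy (inj_eq (pcan_inj pickleK)) !andbT.
by apply: contra xr => /eqP->; rewrite inE eqxx.
Qed.

Fact hfset_key : unit. Proof. exact: tt. Qed.

(* The set whose elements are the members of the list [s]; locked, since
   computing with [pickle] explodes. *)
Definition hfset (s : seq hf) : hf :=
  locked_with hfset_key (Hf (canonical_children_of s)).

Lemma is_set_hfset s : is_set (hfset s).
Proof. by rewrite /hfset unlock. Qed.

Lemma mem_elems_hfset s : elems (hfset s) =i s.
Proof.
move=> x; rewrite /hfset unlock /elems /= mem_pmap_sub /=.
by rewrite mem_sort mem_undup (mem_map val_inj).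
Qed.

Lemma hf_ext x y : is_set x -> is_set y -> elems x =i elems y -> x = y.
Proof.
case: x => [[//|k s] cs]; case: y => [[//|l t] ct] _ _ e.
apply: val_inj => /=.
have in_elems k' u (cu : canonical (GenTree.Node k' u)) z :
    (z \in u) = canonical z && (z \in map val (elems (Hf cu))).
  apply/idP/andP => [zu | [_ /mapP[w]]].
    have cz : canonical z by case/and3P: cu => _ /allP/(_ z zu).
    split=> //; apply/mapP; exists (Hf cz) => //.
    by rewrite /elems /= mem_pmap_sub.
  by rewrite /elems /= mem_pmap_sub => ? ->.
have ie : s =i t.
  move=> z; rewrite (in_elems _ _ cs) (in_elems _ _ ct).
  by congr andb; apply: eq_mem_map.
have /and3P[/eqP-> _ ss] := cs; have /and3P[/eqP-> _ st] := ct.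
congr GenTree.Node; apply: (inj_map (pcan_inj pickleK)).
exact: (irr_sorted_eq ltn_trans ltnn ss st (eq_mem_map _ ie)).
Qed.

Lemma hf_ind_mem (P : hf -> Prop) :
    (forall a, P (atom a)) ->
    (forall x, is_set x -> (forall y, y \in elems x -> P y) -> P x) ->
  forall x, P x.
Proof.
move=> Pa Ps [t]; elim/GenTree.tree_ind: t => [a|k ts IH] ct.
  by rewrite (_ : Hf ct = atom a) //; apply: val_inj.
apply: Ps => // -[u cu]; rewrite /elems /= mem_pmap_sub /= => uts.
elim: ts IH uts {ct} => //= t ts IHts [Pt Pts]; rewrite inE => /predU1P[tu|].
  by subst u; apply: Pt.
exact: IHts.
Qed.

Definition hf0 : hf := hfset [::].

(* Truth values are the sets 0 = {} and 1 = {0}. *)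
Definition hf_bool (b : bool) : hf := if b then hfset [:: hf0] else hf0.

Definition hf_Atoms : hf := hfset [seq atom a | a : I].

(* The atoms among the elements of [x] contribute nothing. *)
Definition hf_union (x : hf) : hf := hfset (flatten (map elems (elems x))).

Definition hf_unique (x : hf) : hf := if elems x is [:: y] then y else hf0.

Definition hf_pair (x y : hf) : hf := hfset [:: x; y].

(* [in_tc y x]: [y] is in the transitive closure of [x], the least transitive
   set having [x] itself as an element. *)
Definition in_tc : hf -> hf -> Prop :=
  clos_refl_trans hf (fun y x => y \in elems x).

End HereditarilyFinite.

Arguments hfset : simpl never.

(** * Input structures *)

Record vocabulary := Vocabulary { rel_sym : finType; rel_arity : rel_sym -> nat }.

Record structure (V : vocabulary) := Structure {
  carrier :> finType;
  interp : forall R : rel_sym V, (rel_arity R).-tuple carrier -> bool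
}.

Arguments interp {V} s R _.

(** * BGS programs

    Syntax is well scoped: [term V n], [formula V n] and [rule V n] may have
    free variables among ['I_n], and binders bind the variable 0.  In
    comprehension terms and do-forall rules the range [r] lives in scope [n], so
    that the bound variable is not free in it.  A [formula] is a Boolean term.

    The dynamic function names come from an infinite supply: for all [k] and
    [f] there is a [k]-ary dynamic function name (used in [TDyn] and [RUpdate])
    and a [k]-ary Boolean one (used in [FDyn] and [RUpdateB]); names
    of distinct arities are distinct.  A program mentions only finitely many. *)

Inductive term (V : vocabulary) : nat -> Type :=
| TVar n (v : 'I_n) : term V n
| TForm n (phi : formula V n) : term V n
| TEmpty n : term V n
| TAtoms n : term V n
| TUnion n (t : term V n) : term V n
| TTheUnique n (t : term V n) : term V n
| TPair n (t u : term V n) : term V n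
| TDyn n (k f : nat) (args : 'I_k -> term V n) : term V n
(* { t(v) : v \in r : phi(v) } *)
| TCompr n (t : term V n.+1) (r : term V n) (phi : formula V n.+1) : term V n
with formula (V : vocabulary) : nat -> Type :=
| FTrue n : formula V n
| FFalse n : formula V n
| FNot n (phi : formula V n) : formula V n
| FAnd n (phi psi : formula V n) : formula V n
| FOr n (phi psi : formula V n) : formula V n
| FEq n (t u : term V n) : formula V n
| FIn n (t u : term V n) : formula V n
| FRel n (R : rel_sym V) (args : 'I_(rel_arity R) -> term V n) : formula V n
| FDyn n (k f : nat) (args : 'I_k -> term V n) : formula V n.

Inductive rule (V : vocabulary) : nat -> Type :=
| RSkip n : rule V n
| RUpdate n (k f : nat) (args : 'I_k -> term V n) (t : term V n) : rule V n
| RUpdateB n (k f : nat) (args : 'I_k -> term V n) (phi : formula V n) : rule V n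
| RIf n (phi : formula V n) (R0 R1 : rule V n) : rule V n
| RForall n (r : term V n) (R0 : rule V n.+1) : rule V n.

Definition program (V : vocabulary) := rule V 0.

Section Semantics.
Variables (V : vocabulary) (A : structure V).

(* [(b, f, xs)] is the location at argument list [xs] of the [size xs]-ary
   dynamic function name [f], the Boolean one if [b] is true. *)
Definition location : Type := bool * nat * seq (hf A).

(* The dynamic part of a state; the static part is determined by [A]. *)
Definition state := location -> hf A.

Definition init_state : state := fun=> hf0 A.

Definition push n (x : hf A) (env : 'I_n -> hf A) : 'I_n.+1 -> hf A :=
  fun i => oapp env x (unlift ord0 i).

Fixpoint teval (s : state) n (t : term V n) : ('I_n -> hf A) -> hf A :=
  match t in term _ n return ('I_n -> hf A) -> hf A with
  | TVar _ v => fun env => env v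
  | TForm _ phi => fun env => hf_bool A (feval s phi env)
  | TEmpty _ => fun=> hf0 A
  | TAtoms _ => fun=> hf_Atoms A
  | TUnion _ t => fun env => hf_union (teval s t env)
  | TTheUnique _ t => fun env => hf_unique (teval s t env)
  | TPair _ t u => fun env => hf_pair (teval s t env) (teval s u env)
  | TDyn _ k f args => fun env =>
      s (false, f, [seq teval s (args i) env | i : 'I_k])
  | TCompr _ t r phi => fun env =>
      hfset [seq teval s t (push x env)
            | x <- elems (teval s r env) & feval s phi (push x env)]
  end
with feval (s : state) n (phi : formula V n) : ('I_n -> hf A) -> bool :=
  match phi in formula _ n return ('I_n -> hf A) -> bool with
  | FTrue _ => fun=> true
  | FFalse _ => fun=> false
  | FNot _ phi => fun env => ~~ feval s phi env
  | FAnd _ phi psi => fun env => feval s phi env && feval s psi env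
  | FOr _ phi psi => fun env => feval s phi env || feval s psi env
  | FEq _ t u => fun env => teval s t env == teval s u env
  | FIn _ t u => fun env => teval s t env \in elems (teval s u env)
  (* input relations are false as soon as an argument is not an atom *)
  | FRel _ R args => fun env =>
      [exists a : (rel_arity R).-tuple A,
        ([seq teval s (args i) env | i : 'I_(rel_arity R)] == map (@atom A) a)
        && interp A R a]
  | FDyn _ k f args => fun env =>
      s (true, f, [seq teval s (args i) env | i : 'I_k]) == hf_bool A true
  end.

Fixpoint updates (s : state) n (R : rule V n) :
    ('I_n -> hf A) -> seq (location * hf A) :=
  match R in rule _ n return ('I_n -> hf A) -> seq (location * hf A) with
  | RSkip _ => fun=> [::]
  | RUpdate _ k f args t => fun env =>
      [:: ((false, f, [seq teval s (args i) env | i : 'I_k]), teval s t env)]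
  | RUpdateB _ k f args phi => fun env =>
      [:: ((true, f, [seq teval s (args i) env | i : 'I_k]),
           hf_bool A (feval s phi env))]
  | RIf _ phi R0 R1 => fun env =>
      if feval s phi env then updates s R0 env else updates s R1 env
  | RForall _ r R0 => fun env =>
      flatten [seq updates s R0 (push x env) | x <- elems (teval s r env)]
  end.

Definition consistent (U : seq (location * hf A)) : bool :=
  all (fun u => all (fun v => (u.1 == v.1) ==> (u.2 == v.2)) U) U.

Definition fire (U : seq (location * hf A)) (s : state) : state :=
  fun l => if [seq u.2 | u <- U & u.1 == l] is x :: _ then x else s l.

Definition no_var : 'I_0 -> hf A := fun i => False_rect _ (notF (ltn_ord i)).

Definition step (P : program V) (s : state) : state :=
  let U := updates s P no_var in if consistent U then fire U s else s.

Definition run (P : program V) (k : nat) : state := iter k (step P) init_state.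

(* Halt and Output are the nullary Boolean dynamic functions 0 and 1. *)
Definition Halt (s : state) : bool := s (true, 0, [::]) == hf_bool A true.
Definition Output (s : state) : bool := s (true, 1, [::]) == hf_bool A true.

Inductive critical (s : state) : hf A -> Prop :=
| CritAtom a : critical s (atom a)
| CritBool b : critical s (hf_bool A b)
| CritValue l : critical s (s l)
| CritArg l x : s l != hf0 A -> x \in l.2 -> critical s x.

Definition active (s : state) (x : hf A) : Prop :=
  exists2 y, critical s y & in_tc x y.

(* Among the states numbered 0 to [k], at most [m] objects are ever active. *)
Definition active_bound (P : program V) (k m : nat) : Prop :=
  exists2 S : seq (hf A), size S <= m
    & forall j x, j <= k -> active (run P j) x -> x \in S.

End Semantics.

Arguments run {V} A P k.

(** * Polynomial time bounded programs *)

Definition query (V : vocabulary) := structure V -> Prop.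

(* On every input [A], the program halts within [p #|A|] steps, with at most
   [q #|A|] active elements, and its output then answers the query. *)
Definition decides_within (V : vocabulary) (P : program V) (p q : {poly nat})
    (Q : query V) : Prop :=
  forall A : structure V, exists k : nat,
    [/\ k <= p.[#|A|]%R,
        Halt (run A P k),
        forall j, j < k -> ~~ Halt (run A P j),
        active_bound A P k q.[#|A|]%R
      & Output (run A P k) <-> Q A].

Definition CPTime (V : vocabulary) (Q : query V) : Prop :=
  exists (P : program V) (p q : {poly nat}), decides_within P p q Q.

(** * Determinants of matrices indexed by a finite set *)

Section SquareDeterminant.
Variables (R : comNzRingType) (I : finType).

Definition sqdet (M : I -> I -> R) : R :=
  (\det (\matrix_(i < #|I|, j < #|I|) M (enum_val i) (enum_val j)))%R.

(* Any other linear ordering of [I] gives the same value. *)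
Lemma sqdet_order (M : I -> I -> R) (e : 'I_#|I| -> I) : injective e ->
  sqdet M = (\det (\matrix_(i < #|I|, j < #|I|) M (e i) (e j)))%R.
Proof.
move=> e_inj; have s_inj : injective (fun i => enum_rank (e i)).
  by move=> i j /enum_rank_inj/e_inj.
rewrite /sqdet; set B := (X in (\det X = _)%R); set C := (X in (_ = \det X)%R).
have -> : C = row_perm (perm s_inj) (col_perm (perm s_inj) B).
  by apply/matrixP => i j; rewrite !mxE !permE !enum_rankK.
rewrite row_permE col_permE !det_mulmx !det_perm mulrCA -signr_addb odd_permV.
by rewrite addbb mulr1.
Qed.

End SquareDeterminant.

(** * Directed graphs *)

Definition digraph_voc : vocabulary := @Vocabulary unit (fun=> 2).

Definition edge (G : structure digraph_voc) (i j : G) : bool :=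
  interp G tt [tuple i; j].

(* The matrix over Z/2 with entry 1 exactly at the edges of [G]. *)
Definition digraph_matrix (G : structure digraph_voc) (i j : G) : 'F_2 :=
  ((edge i j)%:R)%R.

(* Main.v *)
Require Import Defs.
From mathcomp Require Import all_boot all_order all_fingroup all_algebra.
From mathcomp Require Import zify.
From Stdlib Require Import Relation_Operators Operators_Properties.

Set Implicit Arguments.
Unset Strict Implicit.
Unset Printing Implicit Defensive.

(** The loopless complete graph on [n] vertices has determinant [n - 1] mod 2, so it
    suffices that a program cannot tell the complete graph on [I] from the one on
    [option I] when [I] is large.

    The run on [option I] is invariant under all permutations of the atoms.  An
    active object [x] has few images.  Given many disjoint pairs of atoms, greedily
    extract maximal families whose products of swaps all have distinct images of
    [x]; these families have logarithmic size, so some pair is dependent on more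
    families than there are atoms in the support of any element of [x], and then its
    swap fixes [x].  Hence the support of [x] has logarithmic, and by counting images
    again bounded, size.  The values of all terms occurring in the run are then also
    hereditarily of bounded support.

    Dropping hereditarily the objects whose support contains [None] maps such
    objects over [option I] to objects over [I].  It is injective on objects with
    support inside [I] and commutes with the evaluation of terms: an element that
    depends on [None] can be replaced by its image under the swap of [None] with an
    unused atom.  So the two runs correspond step by step. *)

(** * Recursion on hereditarily finite sets *)

Section Recursion.
Variable I : finType.
Implicit Types x y : hf I.

Lemma hf_cases x : (exists a, x = atom a) \/ is_set x.
Proof. by elim/hf_ind_mem: x => [a|x sx _]; [left; exists a | right]. Qed.

Lemma elems_uniq x : uniq (elems x).
Proof.
case: x => -[a|k ts] //= ct; rewrite /elems /=; apply: pmap_sub_uniq.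
case/and3P: ct => _ _ /(sorted_uniq ltn_trans ltnn); exact: map_uniq.
Qed.

Lemma eq_hfset (s t : seq (hf I)) : s =i t -> hfset s = hfset t.
Proof.
move=> st; apply: hf_ext; rewrite ?is_set_hfset // => x.
by rewrite !mem_elems_hfset.
Qed.

Lemma hf_unique_hfset1 x : hf_unique (hfset [:: x]) = x.
Proof.
have := elems_uniq (hfset [:: x]); have := mem_elems_hfset [:: x].
rewrite /hf_unique; case: (elems _) => [/(_ x)|y [|z s]] /=.
- by rewrite !inE eqxx.
- by move=> /(_ x); rewrite !inE eqxx => /eqP.
move=> e; have := e y; have := e z; rewrite !inE !eqxx /= orbT.
by move=> /esym/eqP-> /esym/eqP->; rewrite eqxx.
Qed.

Lemma hf_uniqueP x :
  (exists y, x = hfset [:: y]) \/ hf_unique x = hf0 I.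
Proof.
case: (hf_cases x) => [[a ->]|sx]; first by right.
rewrite /hf_unique; case E: (elems x) => [|y [|z s]]; [by right|left|by right].
by exists y; apply: hf_ext; rewrite ?is_set_hfset // => z; rewrite mem_elems_hfset E.
Qed.

Variables (T : Type) (h : I -> T) (F : seq (hf I * T) -> T).

Fixpoint tree_rec (t : GenTree.tree I) : T :=
  match t with
  | GenTree.Leaf a => h a
  | GenTree.Node _ ts =>
      F (pmap (fun t => omap (fun x => (x, tree_rec t)) (insub t)) ts)
  end.

Definition hf_rec x := tree_rec (val x).

Lemma hf_rec_set x : is_set x ->
  hf_rec x = F [seq (y, hf_rec y) | y <- elems x].
Proof.
case: x => -[a|k ts] //= ct _; rewrite /elems /=; congr F.
elim: ts {ct} => //= t ts ->; case: insubP => //= y _ <-; by [].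
Qed.

End Recursion.

(** * The action of permutations of the atoms *)

Section Action.
Variable I : finType.
Implicit Types (x y : hf I) (g : {perm I}).

Definition hact g : hf I -> hf I :=
  hf_rec (fun a => atom (g a)) (fun s => hfset (unzip2 s)).

Lemma hact_atom g a : hact g (atom a) = atom (g a).
Proof. by []. Qed.

Lemma hact_set g x : is_set x -> hact g x = hfset (map (hact g) (elems x)).
Proof. by move=> sx; rewrite /hact hf_rec_set // /unzip2 -map_comp. Qed.

Lemma is_set_hact g x : is_set (hact g x) = is_set x.
Proof.
by case: (hf_cases x) => [[a ->]|sx] //; rewrite hact_set // is_set_hfset sx.
Qed.

Lemma elems_hact g x : elems (hact g x) =i map (hact g) (elems x).
Proof.
case: (hf_cases x) => [[a ->]|sx] y //.
by rewrite hact_set // mem_elems_hfset.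
Qed.

Lemma hact_hfset g s : hact g (hfset s) = hfset (map (hact g) s).
Proof.
rewrite hact_set ?is_set_hfset //; apply: eq_hfset.
by apply: eq_mem_map; apply: mem_elems_hfset.
Qed.

Lemma hactM g h x : hact (g * h) x = hact h (hact g x).
Proof.
elim/hf_ind_mem: x => [a|x sx IH]; first by rewrite !hact_atom permM.
rewrite !(hact_set _ sx) hact_hfset -map_comp; congr hfset.
by apply/eq_in_map => y yx; rewrite /= IH.
Qed.

Lemma hact1 x : hact 1 x = x.
Proof.
elim/hf_ind_mem: x => [a|x sx IH]; first by rewrite hact_atom perm1.
apply: hf_ext; rewrite ?is_set_hact // => y; rewrite elems_hact.
by rewrite (_ : map _ _ = elems x) //; apply: map_id_in => z /IH.
Qed.

Lemma hactK g : cancel (hact g) (hact g^-1).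
Proof. by move=> x; rewrite -hactM mulgV hact1. Qed.

Lemma hactVK g : cancel (hact g^-1) (hact g).
Proof. by move=> x; rewrite -hactM mulVg hact1. Qed.

Lemma hact_inj g : injective (hact g).
Proof. exact: can_inj (hactK g). Qed.

Lemma hact_tpermK a b : involutive (hact (tperm a b)).
Proof. by move=> x; rewrite -hactM tperm2 hact1. Qed.

Lemma mem_hact g x y : (hact g y \in elems (hact g x)) = (y \in elems x).
Proof. by rewrite elems_hact (mem_map (@hact_inj g)). Qed.

Lemma hact_hf0 g : hact g (hf0 I) = hf0 I.
Proof. by rewrite hact_hfset. Qed.

Lemma hact_bool g b : hact g (hf_bool I b) = hf_bool I b.
Proof. by case: b => /=; [rewrite hact_hfset /= hact_hf0 | exact: hact_hf0]. Qed.

Lemma hact_Atoms g : hact g (hf_Atoms I) = hf_Atoms I.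
Proof.
rewrite hact_hfset; apply: eq_hfset => x; apply/mapP/mapP => [[y]|[a _ ->]].
  by case/mapP=> a _ -> ->; exists (g a); rewrite ?mem_enum.
by exists (atom (g^-1%g a)); rewrite ?hact_atom ?permKV // map_f ?mem_enum.
Qed.

Lemma hact_union g x : hact g (hf_union x) = hf_union (hact g x).
Proof.
rewrite hact_hfset; apply: eq_hfset => y; apply/mapP/flatten_mapP => [[z]|[z]].
  case/flatten_mapP=> u ux zu ->.
  by exists (hact g u); rewrite mem_hact.
rewrite elems_hact => /mapP[u ux ->]; rewrite elems_hact => /mapP[v vu ->].
by exists v => //; apply/flatten_mapP; exists u.
Qed.

Lemma hact_unique g x : hact g (hf_unique x) = hf_unique (hact g x).
Proof.
case: (hf_uniqueP x) => [[y ->]|e]; first by rewrite hact_hfset !hf_unique_hfset1.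
rewrite e; case: (hf_uniqueP (hact g x)) => [[y gx]|->]; last exact: hact_hf0.
move: e; rewrite -[x in hf_unique x](hactK g x) gx hact_hfset !hf_unique_hfset1 => e.
by rewrite -(hactVK g y) e.
Qed.

Lemma hact_pair g x y : hact g (hf_pair x y) = hf_pair (hact g x) (hact g y).
Proof. by rewrite hact_hfset. Qed.

End Action.

(** * Supports *)

Section Supports.
Variable I : finType.
Implicit Types (x y : hf I) (a b c d : I).

(* Fixing [x] under [tperm a d] is an equivalence relation between [a] and [d],
   so the atoms fresh for [x] are those of the class with more than half of the
   atoms, if there is one.  [supp x] is then the least support of [x]; it is the
   full set if there is no such class. *)
Definition fresh a x := #|I| < #|[set d | hact (tperm a d) x == x]|.*2.

Definition supp x := [set a | ~~ fresh a x].

Lemma mem_supp a x : (a \in supp x) = ~~ fresh a x.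
Proof. by rewrite inE. Qed.

Lemma tperm_conj a b d : a != b -> a != d -> b != d ->
  (tperm a d * tperm b d * tperm a d)%g = tperm a b.
Proof.
move=> ab ad bd; have := tpermJ b d (tperm a d).
by rewrite /conjg tpermV mulgA => ->; rewrite tpermR tpermD 1?tpermC // eq_sym.
Qed.

Lemma fix_trans x a b d :
  hact (tperm a d) x = x -> hact (tperm b d) x = x -> hact (tperm a b) x = x.
Proof.
have [->|ab] := eqVneq a b; first by rewrite tperm1 hact1.
have [->|ad] := eqVneq a d; first by rewrite tpermC.
have [->|bd] := eqVneq b d; first by [].
by move=> e f; rewrite -(tperm_conj ab ad bd) !hactM e f e.
Qed.

Lemma fresh_tperm a b x : fresh a x -> fresh b x -> hact (tperm a b) x = x.
Proof.
rewrite /fresh; set A := [set d | _]; set B := [set d | _] => hA hB.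
have /card_gt0P[d] : 0 < #|A :&: B|.
  have := cardsUI A B; have := max_card (A :|: B); lia.
rewrite !inE => /andP[/eqP Ad /eqP Bd]; exact: fix_trans Ad Bd.
Qed.

Lemma fresh_hact (g : {perm I}) a x : fresh (g a) (hact g x) = fresh a x.
Proof.
rewrite /fresh; congr (_ < _.*2).
rewrite -[in RHS](card_imset _ (@perm_inj _ g)); apply: eq_card => d.
rewrite -(permKV g d); move: (g^-1%g d) => {}d; rewrite (mem_imset _ _ (@perm_inj _ g)) !inE.
by rewrite -tpermJ /conjg !hactM hactK (inj_eq (@hact_inj _ g)).
Qed.

Lemma supp_hact (g : {perm I}) x : supp (hact g x) = g @: supp x.
Proof.
apply/setP => a; rewrite -(permKV g a) (mem_imset _ _ (@perm_inj _ g)).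
by rewrite !mem_supp fresh_hact.
Qed.

Lemma supp_sub (B : {set I}) x : #|B|.*2 < #|I| ->
  (forall a b, a \notin B -> b \notin B -> hact (tperm a b) x = x) ->
  supp x \subset B.
Proof.
move=> hB fx; apply/subsetP => a; apply: contraLR => aB.
rewrite mem_supp negbK /fresh.
have : ~: B \subset [set d | hact (tperm a d) x == x].
  by apply/subsetP => d; rewrite !inE => dB; rewrite fx.
move/subset_leq_card; have := cardsC B; lia.
Qed.

Lemma supp_atom a : 2 < #|I| -> supp (atom a) = [set a].
Proof.
move=> hI; apply/eqP; rewrite eqEsubset; apply/andP; split.
  apply: supp_sub => [|b c]; first by rewrite cards1.
  by rewrite !inE hact_atom => ba ca; rewrite tpermD.
apply/subsetP => b; rewrite !inE => /eqP->; rewrite /fresh.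
rewrite -leqNgt (_ : [set d | _] = [set a]) ?cards1; first lia.
apply/setP => d; rewrite !inE hact_atom tpermL.
by apply/eqP/eqP => [[]|->].
Qed.

Lemma exists_fresh (xs : seq (hf I)) :
  sumn [seq #|supp x| | x <- xs] < #|I| -> exists c, all (fresh c) xs.
Proof.
move=> h; set U := \bigcup_(x <- xs) supp x.
have leU : #|U| <= sumn [seq #|supp x| | x <- xs].
  rewrite /U; elim: xs {h U} => [|x xs IH]; rewrite ?big_nil ?cards0 // big_cons /=.
  by apply: leq_trans (leq_card_setU _ _) _; rewrite leq_add2l.
have /card_gt0P[c] : 0 < #|~: U|.
  have := leq_ltn_trans leU h; have := cardsC U; lia.
rewrite inE => hc; exists c; apply/allP => x xs_x.
by apply: contraR hc; rewrite /U (big_rem x) //= in_setU mem_supp => ->.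
Qed.

Definition hsmall m x := forall y, in_tc y x -> #|supp y| <= m.

Lemma hsmall_supp m x : hsmall m x -> #|supp x| <= m.
Proof. by apply; apply: rt_refl. Qed.

Lemma hsmall_elem m x y : hsmall m x -> y \in elems x -> hsmall m y.
Proof.
by move=> hx yx z zy; apply: hx; apply: rt_trans zy _; apply: rt_step.
Qed.

Lemma hsmall_intro m x : #|supp x| <= m ->
  (forall y, y \in elems x -> hsmall m y) -> hsmall m x.
Proof.
move=> sx ex y yx; move: sx ex; case: (clos_rt_rtn1 _ _ _ _ yx) => // z w zw yz _ ew.
by apply: (ew z zw); apply: clos_rtn1_rt.
Qed.

Lemma hsmallW m m' x : m <= m' -> hsmall m x -> hsmall m' x.
Proof. by move=> mm hx y /hx hy; apply: leq_trans hy mm. Qed.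

Lemma hsmall_atom m a : 2 < #|I| -> 0 < m -> hsmall m (atom a).
Proof. by move=> hI m0; apply: hsmall_intro => //; rewrite supp_atom ?cards1. Qed.

End Supports.

(** * Objects with few images have small supports *)

Section SmallSupport.
Variable I : finType.
Implicit Types (x y : hf I) (ps h L : seq (I * I)) (p : I * I).

Definition swap p := hact (tperm p.1 p.2).
Definition swaps ps x := foldr swap x ps.
Definition points ps : seq I := flatten [seq [:: p.1; p.2] | p <- ps].

Lemma mem_points p ps : p \in ps -> (p.1 \in points ps) && (p.2 \in points ps).
Proof.
move=> pps; apply/andP; split; apply/flattenP; exists [:: p.1; p.2];
by rewrite ?inE ?eqxx ?orbT ?(map_f (fun p => [:: p.1; p.2])).
Qed.

Lemma points_sub h ps : {subset h <= ps} -> {subset points h <= points ps}.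
Proof.
move=> hs a /flatten_mapP[p /hs /mem_points /andP[p1 p2]].
by rewrite !inE => /orP[]/eqP->.
Qed.

Lemma size_points ps : size (points ps) = (size ps).*2.
Proof. by elim: ps => //= p ps ->. Qed.

Lemma perm_points_filter (a : pred (I * I)) ps :
  perm_eq (points ps) (points (filter a ps) ++ points (filter (predC a) ps)).
Proof.
rewrite -flatten_cat -map_cat; apply: perm_flatten; apply: perm_map.
by rewrite perm_sym; apply/permPl/perm_filterC.
Qed.

Lemma uniq_points ps : uniq (points ps) -> uniq ps.
Proof.
elim: ps => //= p ps IH /and3P[p1 _ /IH->]; rewrite andbT.
apply: contra p1 => /mem_points/andP[p1 _]; by rewrite inE p1 orbT.
Qed.

Lemma swapK p : involutive (swap p).
Proof. exact: hact_tpermK. Qed.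

Lemma swaps_cat h ps x : swaps (h ++ ps) x = swaps h (swaps ps x).
Proof. exact: foldr_cat. Qed.

Lemma swaps_revK ps x : swaps (rev ps) (swaps ps x) = x.
Proof.
by elim: ps => //= p ps IH; rewrite rev_cons -cats1 swaps_cat /= swapK.
Qed.

Lemma swaps_hact ps : exists g : {perm I}, swaps ps =1 hact g.
Proof.
elim: ps => [|p ps [g IH]]; first by exists 1%g => x; rewrite hact1.
by exists (g * tperm p.1 p.2)%g => x; rewrite hactM -IH.
Qed.

Lemma swaps_fresh ps y : all (fun a => fresh a y) (points ps) -> swaps ps y = y.
Proof.
elim: ps => //= p ps IH /and3P[p1 p2 /IH->]; exact: fresh_tperm.
Qed.

Lemma mem_swaps ps x y : (swaps ps y \in elems (swaps ps x)) = (y \in elems x).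
Proof. by have [g e] := swaps_hact ps; rewrite !e mem_hact. Qed.

Lemma swap_swaps p ps x : p.1 \notin points ps -> p.2 \notin points ps ->
  swap p (swaps ps x) = swaps ps (swap p x).
Proof.
elim: ps => //= q ps IH; rewrite !inE !negb_or => /and3P[p11 p12 p1] /and3P[p21 p22 p2].
rewrite -IH // /swap -!hactM; congr hact; rewrite [RHS]conjgC tpermJ.
by rewrite !tpermD // eq_sym.
Qed.

Fixpoint images x ps : seq (hf I) :=
  if ps is p :: ps' then images x ps' ++ map (swap p) (images x ps') else [:: x].

Lemma size_images x ps : size (images x ps) = 2 ^ size ps.
Proof.
by elim: ps => //= p ps IH; rewrite size_cat size_map IH addnn -mul2n expnS.
Qed.

Lemma imagesP x ps z : z \in images x ps ->
  exists2 h, {subset h <= ps} & z = swaps h x.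
Proof.
elim: ps z => /= [|p ps IH] z; first by rewrite inE => /eqP->; exists [::].
rewrite mem_cat => /orP[/IH[h hps ->]|/mapP[w /IH[h hps ->] ->]].
  by exists h => // q /hps; rewrite inE orbC => ->.
exists (p :: h) => // q; rewrite !inE => /orP[->//|/hps->]; exact: orbT.
Qed.

Definition dependent x p L :=
  exists2 h, {subset h <= L} & swap p (swaps h x) = x.

Lemma max_independent x ps : uniq (points ps) -> exists L,
  [/\ {subset L <= ps}, uniq (images x L)
    & forall p, p \in ps -> p \in L \/ dependent x p L].
Proof.
elim: ps => [|p ps IH] /=; first by exists [::]; split.
rewrite !inE negb_or => /and3P[/andP[p12 p1] p2 ups].
have [L [Lps uL dL]] := IH ups.
have [up|] := boolP (uniq (images x (p :: L))).
  exists (p :: L); split=> // q; rewrite !inE.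
    by case/orP=> [->//|/Lps->]; rewrite orbT.
  case/orP=> [->|/dL[->|[h hL e]]]; [by left|by left; rewrite orbT|right].
  by exists h => // s /hL; rewrite inE orbC => ->.
rewrite /= cat_uniq uL /= (map_inj_uniq (@hact_inj _ _)) uL andbT negbK.
case/hasP=> z /mapP[w /imagesP[h hL ->] ->] /imagesP[h' h'L e].
exists L; split=> // q; first by move/Lps; rewrite inE => ->; rewrite orbT.
rewrite inE => /orP[/eqP->|/dL //]; right; exists (rev h' ++ h).
  by move=> s; rewrite mem_cat mem_rev => /orP[/h'L|/hL].
rewrite swaps_cat swap_swaps; first by rewrite e swaps_revK.
  apply: contra p1; apply: points_sub => s; rewrite mem_rev => /h'L; exact: Lps.
apply: contra p2; apply: points_sub => s; rewrite mem_rev => /h'L; exact: Lps.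
Qed.

(* The sets [h] come from [j] pairwise disjoint maximal independent families,
   hence [B] must miss one of them. *)
Lemma dependent_avoiding x r j ps :
    (forall L, uniq (images x L) -> size L <= r) ->
    uniq (points ps) -> j * r < size ps ->
  exists2 p, p \in ps & forall B : {set I}, count (mem B) (points ps) < j ->
    exists2 h, all [predC B] (points h) & swap p (swaps h x) = x.
Proof.
move=> hr; elim: j ps => [|j IH] ps ups.
  by case: ps ups => // p ps _ _; exists p; rewrite ?inE ?eqxx.
move=> sps; have [L [Lps uL dL]] := max_independent x ups.
have := perm_points_filter (fun q : I * I => q \in L) ps.
set M := [seq q <- ps | _]; set ps' := [seq q <- ps | _] => pps.
have ups' : uniq (points ps').
  by move: ups; rewrite (perm_uniq pps) cat_uniq => /and3P[].
have sL : size M <= size L.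
  apply: uniq_leq_size; first exact: filter_uniq (uniq_points ups).
  by move=> q; rewrite mem_filter => /andP[].
have sps' : j * r < size ps'.
  have := perm_size pps; have := hr L uL; move: sps sL.
  rewrite size_cat !size_points mulSn; lia.
have [p] := IH ps' ups' sps'.
rewrite mem_filter => /andP[/= pL pps0] hp; exists p => // B cB.
have [hL|] := boolP (all [predC B] (points L)).
  have [|[h hL' e]] := dL p pps0; first by rewrite (negPf pL).
  by exists h => //; apply/allP => a /(points_sub hL'); apply: (allP hL).
case/allPn=> a aL /negbNE /= aB; apply: hp.
have : has (mem B) (points M).
  apply/hasP; exists a => //; apply: points_sub aL => q qL.
  by rewrite mem_filter /= qL Lps.
rewrite has_count; move: cB; rewrite (seq.permP pps) count_cat ltnS => cB c0.
by apply: leq_trans cB; rewrite -add1n leq_add2r.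
Qed.

(* For [y] in [x], take [h] avoiding [supp y] with [swap p (swaps h x) = x]: since
   [swaps h] fixes [y], [swap p y] is again in [x]. *)
Lemma exists_swap_fixed x r K ps : is_set x ->
    (forall y, y \in elems x -> #|supp y| <= K) ->
    (forall L, uniq (images x L) -> size L <= r) ->
    uniq (points ps) -> K.+1 * r < size ps ->
  exists2 p, p \in ps & swap p x = x.
Proof.
move=> sx hK hr ups sps; have [p pps hp] := dependent_avoiding hr ups sps.
exists p => //.
have sub y : y \in elems x -> swap p y \in elems x.
  move=> yx; have [|h hB e] := hp (supp y).
    rewrite ltnS; apply: leq_trans (hK y yx).
    rewrite -size_filter -(card_uniqP (filter_uniq _ ups)).
    by apply: subset_leq_card; apply/subsetP => a; rewrite mem_filter => /andP[].
  have hy : swaps h y = y.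
    apply: swaps_fresh; apply: sub_all hB => a /=.
    by rewrite !inE negbK.
  by rewrite -[x in elems x]e mem_hact -hy mem_swaps.
apply: hf_ext => //; first by rewrite is_set_hact.
move=> y; rewrite elems_hact; apply/mapP/idP => [[z zx ->]|yx]; first exact: sub.
by exists (swap p y); rewrite ?sub // -/(swap p) swapK.
Qed.

Lemma matching (e : rel I) t : reflexive e ->
  (exists ps, [/\ size ps = t, uniq (points ps) & all (fun p => ~~ e p.1 p.2) ps]) \/
  (exists2 B : {set I}, #|B| <= t.*2
     & forall a b, a \notin B -> b \notin B -> e a b).
Proof.
move=> re; elim: t => [|t [[ps [<- ups nps]]|[B sB hB]]].
- by left; exists [::].
- pose B := [set a in points ps].
  have [/existsP[p /and3P[p1 p2 ep]]|np] :=
      boolP [exists p : I * I, [&& p.1 \notin B, p.2 \notin B & ~~ e p.1 p.2]].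
    left; exists (p :: ps); split=> //=; last by rewrite ep.
    move: p1 p2; rewrite !inE => p1 p2; rewrite negb_or p1 p2 ups !andbT.
    by apply: contra ep => /eqP->.
  right; exists B => [|a b aB bB].
    rewrite /B cardsE; apply: leq_trans (card_size _) _; rewrite size_points; lia.
  by apply: contraR np => eab; apply/existsP; exists (a, b); rewrite /= aB bB.
- by right; exists B => //; lia.
Qed.

Lemma exists_perm_imset (X Y : {set I}) : #|X| = #|Y| ->
  exists g : {perm I}, g @: X = Y.
Proof.
move e: #|X :\: Y| => n; elim: n X e => [|n IH] X e cXY.
  exists 1%g; apply/eqP; rewrite eqEcard card_imset ?cXY ?leqnn ?andbT; last exact: perm_inj.
  apply/subsetP => _ /imsetP[a aX ->]; rewrite perm1.
  apply: contraT => aY; suff : a \in X :\: Y by rewrite (cards0_eq e) inE.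
  by rewrite inE aY aX.
have /card_gt0P[a] : 0 < #|X :\: Y| by rewrite e.
have /card_gt0P[b] : 0 < #|Y :\: X|.
  by have := cardsID Y X; have := cardsID X Y; rewrite setIC; lia.
rewrite !inE => /andP[bX bY] /andP[aY aX].
have [||g hg] := IH (tperm a b @: X).
- apply/eqP; rewrite -eqSS -e (cardsD1 a (X :\: Y)) !inE aX aY add1n eqSS.
  apply/eqP; apply: eq_card => c; rewrite -(tpermK a b c) !inE.
  rewrite (mem_imset _ _ perm_inj) tpermK.
  case: (tpermP a b c) => [->|->|ca cb]; rewrite ?bX ?bY ?aX ?aY ?eqxx //=.
  - exact: negbTE.
  - by rewrite andbF.
  - by rewrite (introN eqP ca).
- by rewrite card_imset //; apply: perm_inj.
exists (tperm a b * g)%g; rewrite -hg -imset_comp; apply: eq_imset => c.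
by rewrite permM.
Qed.

(* First [supp x] has less than half of the atoms, by [matching].  Then exchanging
   [K.+1] of its elements for atoms outside gives as many images of [x] as there
   are choices of these atoms. *)
Lemma supp_few_images x (S : seq (hf I)) r K : is_set x ->
    (forall y, y \in elems x -> #|supp y| <= K) ->
    (forall g, hact g x \in S) ->
    size S < 2 ^ r -> 4 * (K.+1 * r).+1 < #|I| ->
    size S < 'C(#|I|./2, K.+1) ->
  #|supp x| <= K.
Proof.
move=> sx hK imS hr hI hC.
have ind L : uniq (images x L) -> size L <= r.
  move=> uL; rewrite leqNgt; apply/negP => rL.
  have : size (images x L) <= size S.
    by apply: (uniq_leq_size uL) => z /imagesP[h _ ->]; have [g ->] := swaps_hact h.
  have : 2 ^ r <= 2 ^ size L by rewrite leq_exp2l // ltnW.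
  by rewrite size_images; lia.
have [|[ps [sps ups]]|[B sB hB]] :=
    @matching (fun a b => hact (tperm a b) x == x) (K.+1 * r).+1.
- by move=> a; rewrite tperm1 hact1.
- have [|p pps e] := exists_swap_fixed sx hK ind ups; first by rewrite sps.
  by move/allP/(_ p pps); rewrite -/(swap p x) e eqxx.
have sI : #|supp x| <= #|B|.
  apply: subset_leq_card; apply: supp_sub => [|a b aB bB]; first lia.
  by apply/eqP; apply: hB.
rewrite leqNgt; apply/negP => Ks.
have [Z Zs cZ] : exists2 Z : {set I}, Z \subset supp x & #|Z| = #|supp x| - K.+1.
  have /card_gt0P[Z] : 0 < #|[set Z : {set I} | Z \subset supp x & #|Z| == #|supp x| - K.+1]|.
    by rewrite cards_draws bin_gt0 leq_subr.
  by rewrite inE => /andP[Zs /eqP cZ]; exists Z.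
set D := ~: supp x; set Ts := [set T : {set I} | T \subset D & #|T| == K.+1].
have cF : #|[set Z :|: T | T in Ts]| = 'C(#|D|, K.+1).
  rewrite card_in_imset ?cards_draws // => T U; rewrite !inE.
  have ZD : Z :&: D = set0.
    by apply/eqP; rewrite setI_eq0 disjoints_subset setCK.
  move=> /andP[/setIidPl TD _] /andP[/setIidPl UD _] /(congr1 (fun A => A :&: D)).
  by rewrite !setIUl ZD !set0U TD UD.
have : #|[set Z :|: T | T in Ts]| <= size S.
  rewrite -(size_map (@supp I)); apply: leq_trans (card_size _).
  apply/subset_leq_card/subsetP => Y /imsetP[T]; rewrite inE => /andP[TD /eqP cT] ->.
  have [g <-] : exists g : {perm I}, g @: supp x = Z :|: T.
    apply: exists_perm_imset; rewrite cardsU cZ cT (_ : Z :&: T = set0).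
      by rewrite cards0; lia.
    apply/eqP; rewrite setI_eq0 disjoint_sym disjoints_subset.
    by apply: subset_trans TD _; rewrite setCS.
  by rewrite -supp_hact map_f.
have : 'C(#|I|./2, K.+1) <= 'C(#|D|, K.+1).
  apply: leq_bin2l; have := cardsC (supp x); rewrite -/D; lia.
by rewrite cF; lia.
Qed.

End SmallSupport.

Lemma horner_nat_bound (q : {poly nat}) :
  exists C d, forall n, 0 < n -> q.[n]%R <= C * n ^ d.
Proof.
elim/poly_ind: q => [|q c [C [d IH]]].
  by exists 0, 0 => n _; rewrite horner0.
exists (C + c), d.+1 => n n0; rewrite hornerMXaddC.
have -> : (q.[n] * n + c)%R = q.[n]%R * n + c by [].
have := IH n n0; have : 0 < n ^ d.+1 by rewrite expn_gt0 n0.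
rewrite expnS; nia.
Qed.

Lemma ffact_lower m k : (m - k) ^ k <= m ^_ k.
Proof.
elim: k => // k IH; rewrite ffactnSr expnSr; apply: leq_mul; last lia.
by apply: leq_trans IH; case: (k) => // j; rewrite leq_exp2r; lia.
Qed.

Lemma bin_le_exp2 n k : 'C(n, k) <= 2 ^ n.
Proof.
elim: n k => [|n IH] [|k]; rewrite ?bin0 ?expn_gt0 // binS expnS mul2n -addnn.
exact: leq_add.
Qed.

Lemma bin_large C d L : 0 < L -> exists N, forall n, N <= n ->
  C * n ^ d < 'C(n %/ L, d.+1).
Proof.
move=> L0; pose E := (2 * L) ^ d.+1 * d.+1`!.
exists (4 * L * (d.+2) + E * C).+1 => n hn.
have E0 : 0 < E by rewrite muln_gt0 expn_gt0 fact_gt0 muln_gt0 L0.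
have h1 : n <= 2 * L * (n %/ L - d.+1).
  have := divn_eq n L; have := ltn_pmod n L0; move: (n %/ L) (n %% L) => m s; nia.
rewrite -(ltn_pmul2l E0).
have : n ^ d.+1 <= E * 'C(n %/ L, d.+1).
  rewrite /E -mulnA [_`! * _]mulnC bin_ffact.
  apply: leq_trans (leq_mul (leqnn _) (ffact_lower _ _)).
  by rewrite -expnMn leq_exp2r.
apply: leq_trans; rewrite expnS mulnA ltn_mul2r expn_gt0; lia.
Qed.

Lemma poly_thresholds (q : {poly nat}) : exists K N, forall n, N <= n ->
  0 < K /\ exists r,
  [/\ q.[n]%R < 2 ^ r, 4 * (K.+1 * r).+1 < n & q.[n]%R < 'C(n./2, K.+1)].
Proof.
have [C [d hq]] := horner_nat_bound q.
have [N1 h1] := @bin_large C d.+1 (8 * d.+2) isT.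
have [N2 h2] := @bin_large C d.+1 2 isT.
exists d.+1, (maxn 9 (maxn N1 N2)) => n; rewrite !geq_max => /and3P[n9 n1 n2].
split=> //; exists (n %/ (8 * d.+2)).
have hqn : q.[n]%R <= C * n ^ d.+1.
  apply: leq_trans (hq n _) _; first lia.
  by rewrite leq_mul2l leq_pexp2l ?orbT //; lia.
split.
- exact: leq_trans (leq_ltn_trans hqn (h1 n n1)) (bin_le_exp2 _ _).
- have := leq_divM n (8 * d.+2); move: (n %/ _) => r; lia.
- by rewrite -divn2; apply: leq_ltn_trans hqn (h2 n n2).
Qed.

(** * Equivariance of runs *)

Scheme term_formula_rect := Induction for term Sort Prop
  with formula_term_rect := Induction for formula Sort Prop.
Combined Scheme term_formula_ind from term_formula_rect, formula_term_rect.

Section Equivariance.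
Variables (V : vocabulary) (B : structure V).
Implicit Types (g : {perm B}) (s : state B) (x y : hf B) (l : location B).

Definition symmetric_structure :=
  forall g (R : rel_sym V) (a : (rel_arity R).-tuple B),
    interp B R (map_tuple g a) = interp B R a.

Definition lact g l : location B := (l.1, map (hact g) l.2).

Definition equivariant s := forall g l, s (lact g l) = hact g (s l).

Lemma lactK g : cancel (lact g) (lact g^-1%g).
Proof. by case=> f xs; rewrite /lact /= mapK //; apply: hactK. Qed.

Lemma push_hact g n x (env env' : 'I_n -> hf B) :
  (forall i, env' i = hact g (env i)) ->
  forall i, push (hact g x) env' i = hact g (push x env i).
Proof. by move=> e i; rewrite /push; case: unlift. Qed.

Hypothesis symB : symmetric_structure.

Section Evaluation.
Variable s : state B.
Hypothesis eqs : equivariant s.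

Lemma eval_hact g :
  (forall n (t : term V n) env env', (forall i, env' i = hact g (env i)) ->
     teval s t env' = hact g (teval s t env)) /\
  (forall n (phi : formula V n) env env', (forall i, env' i = hact g (env i)) ->
     feval s phi env' = feval s phi env).
Proof.
apply: (term_formula_ind
  (P := fun n t => forall env env', (forall i, env' i = hact g (env i)) ->
     teval s t env' = hact g (teval s t env))
  (P0 := fun n phi => forall env env', (forall i, env' i = hact g (env i)) ->
     feval s phi env' = feval s phi env)) => /=.
- by [].
- by move=> n phi IH env env' /IH->; rewrite hact_bool.
- by move=> *; rewrite hact_hf0.
- by move=> *; rewrite hact_Atoms.
- by move=> n t IH env env' /IH->; rewrite hact_union.
- by move=> n t IH env env' /IH->; rewrite hact_unique.
- by move=> n t IHt u IHu env env' e; rewrite (IHt _ _ e) (IHu _ _ e) hact_pair.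
- move=> n k f args IH env env' e; rewrite -eqs /lact /= -map_comp.
  by congr (s (_, _, _)); apply: eq_map => i /=; apply: IH.
- move=> n t IHt r IHr phi IHp env env' e; rewrite hact_hfset.
  apply: eq_hfset => y; apply/mapP/mapP => [[x]|[z /mapP[x]]].
    rewrite mem_filter (IHr _ _ e) elems_hact => /andP[px /mapP[z zr xz]] ->.
    have ez := push_hact z e; rewrite xz in px *.
    exists (teval s t (push z env)); last exact: IHt.
    by rewrite map_f // mem_filter -(IHp _ _ ez) px.
  rewrite mem_filter => /andP[px xr] -> ->; have ex := push_hact x e.
  exists (hact g x); last by rewrite (IHt _ _ ex).
  by rewrite mem_filter (IHp _ _ ex) px (IHr _ _ e) mem_hact.
- by [].
- by [].
- by move=> n phi IH env env' /IH->.
- by move=> n phi IHp psi IHq env env' e; rewrite (IHp _ _ e) (IHq _ _ e).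
- by move=> n phi IHp psi IHq env env' e; rewrite (IHp _ _ e) (IHq _ _ e).
- move=> n t IHt u IHu env env' e; rewrite (IHt _ _ e) (IHu _ _ e).
  by rewrite (inj_eq (@hact_inj _ _)).
- by move=> n t IHt u IHu env env' e; rewrite (IHt _ _ e) (IHu _ _ e) mem_hact.
- move=> n R args IH env env' e.
  have -> : [seq teval s (args i) env' | i : 'I_(rel_arity R)] =
      map (hact g) [seq teval s (args i) env | i : 'I_(rel_arity R)].
    by rewrite -map_comp; apply: eq_map => i /=; apply: IH.
  set us := [seq teval s _ env | i : _].
  have hg (h : {perm B}) (a : (rel_arity R).-tuple B) :
      map (@atom B) (map_tuple h a) = map (hact h) (map (@atom B) a).
    by rewrite -!map_comp; apply: eq_map.
  apply/existsP/existsP => -[a /andP[/eqP ua ia]]; last first.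
    by exists (map_tuple g a); rewrite symB ia andbT hg ua.
  exists (map_tuple g^-1%g a); rewrite symB ia andbT hg -ua mapK //; exact: hactK.
- move=> n k f args IH env env' e.
  rewrite -[hfset _]/(hf_bool B true) -[RHS](inj_eq (@hact_inj _ g)) hact_bool -eqs /lact /= -map_comp.
  by congr (s (_, _, _) == _); apply: eq_map => i /=; apply: IH.
Qed.

Lemma updates_hact g n (R : rule V n) env env' u :
    (forall i, env' i = hact g (env i)) ->
  u \in updates s R env -> (lact g u.1, hact g u.2) \in updates s R env'.
Proof.
have [et ef] := eval_hact g.
elim: R env env' u => {n} [n|n k f args t|n k f args phi|n phi R0 IH0 R1 IH1|n r R0 IH]
  env env' u e //=.
- rewrite !inE => /eqP->; rewrite (et _ _ _ _ e) /lact /= -map_comp.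
  by apply/eqP; congr (_, _, _, _); apply: eq_map => i /=; rewrite (et _ _ _ _ e).
- rewrite !inE => /eqP->; rewrite (ef _ _ _ _ e) /lact /= -map_comp hact_bool.
  by apply/eqP; congr (_, _, _, _); apply: eq_map => i /=; rewrite (et _ _ _ _ e).
- by rewrite (ef _ _ _ _ e); case: ifP => _; [apply: IH0 | apply: IH1].
- case/flatten_mapP=> x xr ux; apply/flatten_mapP; exists (hact g x).
    by rewrite (et _ _ _ _ e) mem_hact.
  by apply: IH ux; apply: push_hact.
Qed.

End Evaluation.

Lemma fireP (U : seq (location B * hf B)) s l : consistent U ->
  (exists2 x, (l, x) \in U & fire U s l = x) \/
  (forall x, (l, x) \notin U) /\ fire U s l = s l.
Proof.
move=> cU; rewrite /fire; case E: [seq u.2 | u <- U & u.1 == l] => [|x xs].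
  right; split=> // x; apply/negP => lx.
  have : x \in [seq u.2 | u <- U & u.1 == l].
    by apply/mapP; exists (l, x); rewrite ?mem_filter ?eqxx.
  by rewrite E.
left; exists x => //.
have : x \in [seq u.2 | u <- U & u.1 == l] by rewrite E mem_head.
by case/mapP=> -[l' x']; rewrite mem_filter /= => /andP[/eqP<-] ? ->.
Qed.

Lemma fire_mem (U : seq (location B * hf B)) s l x : consistent U ->
  (l, x) \in U -> fire U s l = x.
Proof.
move=> cU lx; have [[y ly ->]|[/(_ x)]] := fireP s l cU; last by rewrite lx.
by have /allP/(_ _ lx)/allP/(_ _ ly)/= := cU; rewrite eqxx => /eqP.
Qed.

Lemma step_equivariant (P : program V) s : equivariant s -> equivariant (step P s).
Proof.
move=> eqs g l; rewrite /step; case: ifP => // cU; set U := updates _ _ _ in cU *.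
have UP (h : {perm B}) l' x : (l', x) \in U -> (lact h l', hact h x) \in U.
  by move/(updates_hact eqs (g := h)); apply => -[].
have [[x lx ->]|[nl ->]] := fireP s l cU; first exact: fire_mem (UP _ _ _ lx).
have [[x lx _]|[_ ->]] := fireP s (lact g l) cU; last exact: eqs.
by have := nl (hact g^-1%g x); rewrite -(lactK g l) UP.
Qed.

Lemma run_equivariant (P : program V) k : equivariant (run B P k).
Proof.
elim: k => [|k IH]; first by move=> g l; rewrite /run /= /init_state hact_hf0.
exact: step_equivariant.
Qed.

Lemma critical_hact s g x : equivariant s -> critical s x -> critical s (hact g x).
Proof.
move=> eqs; case=> [a|b|l|l y sl yl]; first exact: CritAtom.
- by rewrite hact_bool; apply: CritBool.
- by rewrite -eqs; apply: CritValue.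
apply: (@CritArg _ _ _ (lact g l)); last exact: map_f.
by rewrite eqs -(hact_hf0 g) (inj_eq (@hact_inj _ _)).
Qed.

Lemma active_hact s g x : equivariant s -> active s x -> active s (hact g x).
Proof.
move=> eqs [y cy xy]; exists (hact g y); first exact: critical_hact.
elim: xy => [u v uv|u|u v w _ uv _ vw]; last exact: rt_trans uv vw.
  by apply: rt_step; rewrite mem_hact.
exact: rt_refl.
Qed.

Lemma active_elem s x y : active s x -> y \in elems x -> active s y.
Proof.
by move=> [z cz xz] yx; exists z => //; apply: rt_trans xz; apply: rt_step.
Qed.

Lemma active_supp (s : state B) (S : seq (hf B)) r K x :
    equivariant s -> (forall y, active s y -> y \in S) ->
    0 < K -> size S < 2 ^ r -> 4 * (K.+1 * r).+1 < #|B| ->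
    size S < 'C(#|B|./2, K.+1) ->
  active s x -> #|supp x| <= K.
Proof.
move=> eqs hS K0 h1 h2 h3; elim/hf_ind_mem: x => [a _|x sx IH ax].
  by rewrite supp_atom ?cards1 //; lia.
apply: (@supp_few_images _ x S r) => // [y yx|g].
  by apply: IH => //; apply: active_elem ax yx.
by apply: hS; apply: active_hact.
Qed.

Lemma active_hsmall (s : state B) (S : seq (hf B)) r K l :
    equivariant s -> (forall y, active s y -> y \in S) ->
    0 < K -> size S < 2 ^ r -> 4 * (K.+1 * r).+1 < #|B| ->
    size S < 'C(#|B|./2, K.+1) ->
  hsmall K (s l).
Proof.
move=> eqs hS K0 h1 h2 h3 y yx; apply: (active_supp eqs hS K0 h1 h2 h3).
by exists (s l) => //; apply: CritValue.
Qed.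

End Equivariance.

(** * Hereditary smallness of the values of terms *)

Lemma exists_fresh_hsmall (I : finType) m (xs : seq (hf I)) :
    (forall x, x \in xs -> hsmall m x) -> size xs * m < #|I| ->
  exists c, all (fun x => fresh c x) xs.
Proof.
move=> hx hI; apply: exists_fresh; apply: leq_ltn_trans hI.
elim: xs hx => //= x xs IH hx; rewrite mulSn leq_add //.
  by apply/hsmall_supp/hx/mem_head.
by apply: IH => y yx; apply: hx; rewrite inE yx orbT.
Qed.

Lemma supp_invariant (I : finType) (x : hf I) :
  0 < #|I| -> (forall g, hact g x = x) -> supp x = set0.
Proof.
move=> hI hx; apply/eqP; rewrite -subset0; apply: supp_sub => //.
by rewrite cards0.
Qed.

Lemma hsmall_hf0 (I : finType) m : 0 < #|I| -> hsmall m (hf0 I).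
Proof.
move=> hI; apply: hsmall_intro => [|y].
  by rewrite supp_invariant ?cards0 // => g; apply: hact_hf0.
by rewrite mem_elems_hfset.
Qed.

Lemma hsmall_bool (I : finType) m b : 0 < #|I| -> hsmall m (hf_bool I b).
Proof.
move=> hI; case: b; last exact: hsmall_hf0.
apply: hsmall_intro => [|y].
  by rewrite supp_invariant ?cards0 // => g; apply: (hact_bool g true).
by rewrite mem_elems_hfset inE => /eqP->; apply: hsmall_hf0.
Qed.

Lemma hsmall_push (V : vocabulary) (B : structure V) m n (x : hf B) (env : 'I_n -> hf B) :
  hsmall m x -> (forall i, hsmall m (env i)) -> forall i, hsmall m (push x env i).
Proof. by move=> hx he i; rewrite /push; case: unlift. Qed.

Definition small_state (V : vocabulary) (B : structure V) k (s : state B) :=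
  [/\ symmetric_structure B, equivariant s & forall l, hsmall k (s l)].

Section Values.
Variables (V : vocabulary) (B : structure V) (k : nat) (s : state B).
Hypothesis hs : small_state k s.

Lemma supp_teval n (t : term V n) m (env : 'I_n -> hf B) :
    (forall i, hsmall m (env i)) -> (n * m).*2 < #|B| ->
  supp (teval s t env) \subset \bigcup_i supp (env i) /\
  #|supp (teval s t env)| <= n * m.
Proof.
have [symB eqs _] := hs; move=> he hB; set U := \bigcup_i supp (env i).
have cU : #|U| <= n * m.
  apply: (@leq_trans (\sum_i #|supp (env i)|)); last first.
    rewrite -[n in n * m]card_ord -sum_nat_const.
    by apply: leq_sum => i _; apply/hsmall_supp/he.
  rewrite /U.
  elim/big_rec2: _ => [|i p A _ IH]; first by rewrite cards0.
  by apply: leq_trans (leq_card_setU _ _) _; rewrite leq_add2l.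
have sU : supp (teval s t env) \subset U.
  apply: supp_sub => [|a b aU bU]; first by apply: leq_ltn_trans hB; rewrite leq_double.
  have [et _] := eval_hact symB eqs (tperm a b); apply/esym/et => i.
  have fr c : c \notin U -> fresh c (env i).
    move=> cU'; apply: contraR cU'; rewrite -mem_supp => ci.
    by apply/bigcupP; exists i.
  by rewrite fresh_tperm ?fr.
by split=> //; apply: leq_trans (subset_leq_card sU) cU.
Qed.

Lemma fresh_teval n (t : term V n) m (env : 'I_n -> hf B) c :
    (forall i, hsmall m (env i)) -> (n * m).*2 < #|B| ->
  (forall i, fresh c (env i)) -> fresh c (teval s t env).
Proof.
move=> he hB fc; have [/subsetP/(_ c) sU _] := supp_teval t he hB.
apply: contraT; rewrite -mem_supp => /sU /bigcupP[i _].
by rewrite mem_supp fc.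
Qed.

End Values.

Lemma fin_leq_bound (T : finType) (P : T -> nat -> Prop) :
    (forall i, exists m, P i m) -> (forall i m m', m <= m' -> P i m -> P i m') ->
  exists m, forall i, P i m.
Proof.
move=> /fin_all_exists[f hf] mono; exists (\max_i f i) => i.
exact: mono (leq_bigmax i) (hf i).
Qed.

(* [simpl] makes the two elaborations of a cardinal agree syntactically. *)
Ltac card_lia := simpl in *; lia.

Lemma teval_hsmall (V : vocabulary) n (t : term V n) k m :
  exists N, forall (B : structure V) (s : state B) (env : 'I_n -> hf B),
    small_state k s -> N <= #|B| -> (forall i, hsmall m (env i)) ->
  hsmall N (teval s t env).
Proof.
move: k m; apply: (term_formula_rect
  (P := fun n t => forall k m, exists N, forall (B : structure V) (s : state B)
    (env : 'I_n -> hf B), small_state k s -> N <= #|B| ->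
      (forall i, hsmall m (env i)) -> hsmall N (teval s t env))
  (P0 := fun _ _ => True)) => //= {n t}.
- by move=> n v k m; exists m => B s env _ _; apply.
- by move=> n phi _ k m; exists 1 => B s env _ hB _; apply: hsmall_bool.
- by move=> n k m; exists 1 => B s env _ hB _; apply: hsmall_hf0.
- move=> n k m; exists 3 => B s env _ hB _; apply: hsmall_intro => [|y].
    rewrite supp_invariant ?cards0 //; first exact: leq_trans hB.
    by move=> g; apply: hact_Atoms.
  by rewrite mem_elems_hfset => /mapP[a _ ->]; apply: hsmall_atom.
- move=> n t IH k m; have [N hN] := IH k m.
  exists (N + (n * m).*2.+1) => B s env hs hB he; apply: hsmall_intro => [|y].
    have [|_ le] := supp_teval hs (TUnion t) he; first card_lia.
    by apply: leq_trans le _; card_lia.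
  rewrite mem_elems_hfset => /flatten_mapP[u ut yu].
  apply: hsmallW (leq_addr _ _) _; apply: hsmall_elem yu; apply: hsmall_elem ut.
  by apply: hN => //; card_lia.
- move=> n t IH k m; have [N hN] := IH k m.
  exists N.+1 => B s env hs hB he; have hB' : N <= #|B| by card_lia.
  have [[y e]|->] := hf_uniqueP (teval s t env); last by apply: hsmall_hf0; card_lia.
  have := hN B s env hs hB' he; rewrite e hf_unique_hfset1 => /hsmall_elem h.
  by apply: hsmallW (leqnSn _) (h _ _); rewrite mem_elems_hfset mem_head.
- move=> n t IHt u IHu k m; have [N hN] := IHt k m; have [N' hN'] := IHu k m.
  exists (N + N' + (n * m).*2.+1) => B s env hs hB he.
  apply: hsmall_intro => [|y].
    have [|_ le] := supp_teval hs (TPair t u) he; first card_lia.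
    by apply: leq_trans le _; card_lia.
  rewrite mem_elems_hfset !inE => /orP[]/eqP->.
    by apply: (@hsmallW _ N); [card_lia | apply: hN => //; card_lia].
  by apply: (@hsmallW _ N'); [card_lia | apply: hN' => //; card_lia].
- by move=> n k' f args _ k m; exists k => B s env [_ _ hs] _ _; apply: hs.
- move=> n t IHt r IHr phi _ k m; have [N hN] := IHr k m.
  have [N' hN'] := IHt k (maxn m N).
  exists (N + N' + (n * m).*2.+1) => B s env hs hB he.
  apply: hsmall_intro => [|y].
    have [|_ le] := supp_teval hs (TCompr t r phi) he; first card_lia.
    by apply: leq_trans le _; card_lia.
  rewrite mem_elems_hfset => /mapP[x]; rewrite mem_filter => /andP[_ xr] ->.
  apply: (@hsmallW _ N'); first card_lia.
  apply: hN' => //; [card_lia | apply: hsmall_push => [|i]].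
    by apply: hsmallW (leq_maxr _ _) _; apply: hsmall_elem xr; apply: hN => //; card_lia.
  exact: hsmallW (leq_maxl _ _) (he i).
Qed.

Lemma args_hsmall (V : vocabulary) n j (args : 'I_j -> term V n) k m :
  exists N, forall i (B : structure V) (s : state B) (env : 'I_n -> hf B),
    small_state k s -> N <= #|B| -> (forall i, hsmall m (env i)) ->
  hsmall N (teval s (args i) env).
Proof.
apply: (fin_leq_bound (P := fun i N => forall (B : structure V) (s : state B)
  (env : 'I_n -> hf B), small_state k s -> N <= #|B| ->
    (forall i, hsmall m (env i)) -> hsmall N (teval s (args i) env))).
  by move=> i; apply: teval_hsmall.
move=> i N N' NN hN B s env hs hB he.
exact: hsmallW NN (hN _ _ _ hs (leq_trans NN hB) he).
Qed.

Definition small_update (I : finType) N (u : bool * nat * seq (hf I) * hf I) :=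
  [/\ size u.1.2 <= N, forall x, x \in u.1.2 -> hsmall N x & hsmall N u.2].

Lemma small_updateW (I : finType) N N' (u : bool * nat * seq (hf I) * hf I) :
  N <= N' -> small_update N u -> small_update N' u.
Proof.
move=> NN [h1 h2 h3]; by split=> [|x /h2|];
  [exact: leq_trans h1 NN | apply: hsmallW | apply: hsmallW h3].
Qed.

Lemma updates_hsmall (V : vocabulary) n (R : rule V n) k m :
  exists N, forall (B : structure V) (s : state B) (env : 'I_n -> hf B) u,
    small_state k s -> N <= #|B| -> (forall i, hsmall m (env i)) ->
  u \in updates s R env -> small_update N u.
Proof.
elim: R m => {n} [n|n j f args t|n j f args phi|n phi R0 IH0 R1 IH1|n r R0 IH] m /=.
- by exists 0.
- have [N hN] := args_hsmall args k m; have [N' hN'] := teval_hsmall t k m.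
  exists (j + N + N') => B s env u hs hB he; rewrite inE => /eqP-> /=; split=> /=.
  + by rewrite size_map -cardE card_ord; card_lia.
  + move=> x /mapP[i _ ->]; apply: (@hsmallW _ N); first card_lia.
    by apply: hN => //; card_lia.
  by apply: (@hsmallW _ N'); [card_lia | apply: hN' => //; card_lia].
- have [N hN] := args_hsmall args k m.
  exists (j + N + 1) => B s env u hs hB he; rewrite inE => /eqP-> /=; split=> /=.
  + by rewrite size_map -cardE card_ord; card_lia.
  + move=> x /mapP[i _ ->]; apply: (@hsmallW _ N); first card_lia.
    by apply: hN => //; card_lia.
  by apply: hsmall_bool; card_lia.
- have [N hN] := IH0 m; have [N' hN'] := IH1 m.
  exists (N + N') => B s env u hs hB he; case: ifP => _ uR.
    apply: (small_updateW (leq_addr N' N)); apply: hN uR => //; card_lia.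
  apply: (small_updateW (leq_addl N N')); apply: hN' uR => //; card_lia.
- have [N hN] := teval_hsmall r k m; have [N' hN'] := IH (maxn m N).
  exists (N + N') => B s env u hs hB he /flatten_mapP[x xr uR].
  apply: (small_updateW (leq_addl N N')); apply: hN' uR => //; first card_lia.
  apply: hsmall_push => [|i]; last exact: hsmallW (leq_maxl _ _) (he i).
  apply: hsmallW (leq_maxr _ _) _; apply: hsmall_elem xr; apply: hN => //; card_lia.
Qed.

(** * Restriction to all atoms but one *)

Section Restriction.
Variable I : finType.
Notation J := (option I).
Implicit Types (x y z : hf J).

Definition sfresh x := fresh None x.

(* Hereditarily drops the elements whose support contains the atom [None], so that
   [{J \ {b} : b in J}] becomes [{I \ {a} : a in I}].  The value at [None] is junk. *)
Definition restr : hf J -> hf I :=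
  hf_rec (fun b => if b is Some a then atom a else hf0 I)
         (fun s => hfset [seq u.2 | u <- s & sfresh u.1]).

Lemma restr_set x : is_set x ->
  restr x = hfset [seq restr y | y <- elems x & sfresh y].
Proof.
by move=> sx; rewrite /restr hf_rec_set // filter_map -map_comp.
Qed.

Lemma elems_restr x : elems (restr x) =i [seq restr y | y <- elems x & sfresh y].
Proof.
case: (hf_cases x) => [[[a|] ->]|sx] y //; last by rewrite restr_set // mem_elems_hfset.
by rewrite mem_elems_hfset.
Qed.

Lemma elems_restrP x w :
  reflect (exists y, [/\ y \in elems x, sfresh y & w = restr y]) (w \in elems (restr x)).
Proof.
rewrite elems_restr; apply: (iffP mapP) => [[y]|[y [yx sy ->]]].
  by rewrite mem_filter => /andP[sy yx] ->; exists y.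
by exists y; rewrite // mem_filter sy.
Qed.

Lemma restr_hfset s : restr (hfset s) = hfset [seq restr y | y <- s & sfresh y].
Proof.
rewrite restr_set ?is_set_hfset //; apply/eq_hfset/eq_mem_map => y.
by rewrite !mem_filter mem_elems_hfset.
Qed.

Lemma sfresh_hact c x : sfresh (hact (tperm None c) x) = fresh c x.
Proof. by rewrite /sfresh -[in RHS](fresh_hact (tperm None c)) tpermR. Qed.

Lemma sfresh_fixed c x : fresh c x -> sfresh x -> hact (tperm None c) x = x.
Proof. by move=> fc fN; apply: fresh_tperm. Qed.

Lemma sfresh_atom b : 2 < #|{: J}| -> sfresh (atom b) = (b != None).
Proof.
by move=> hJ; rewrite -[LHS]negbK -mem_supp supp_atom // inE eq_sym.
Qed.

Lemma sfresh_invariant x : 0 < #|{: J}| -> (forall g, hact g x = x) -> sfresh x.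
Proof. by move=> hJ hx; rewrite -[sfresh x]negbK -mem_supp supp_invariant ?inE. Qed.

Lemma is_set_restr x : 2 < #|{: J}| -> sfresh x -> is_set (restr x) = is_set x.
Proof.
move=> hJ; case: (hf_cases x) => [[b ->]|sx].
  by rewrite sfresh_atom //; case: b.
by rewrite restr_set // is_set_hfset sx.
Qed.

Lemma restr_hf0 : restr (hf0 J) = hf0 I.
Proof. by rewrite restr_hfset. Qed.

Section Small.
Variable m : nat.
Hypothesis hm : 3 * m.+1 < #|{: J}|.

Let hJ : 2 < #|{: J}|.
Proof. by apply: leq_ltn_trans hm; lia. Qed.

Lemma sfresh_hf0 : sfresh (hf0 J).
Proof. by apply: sfresh_invariant => [|g]; [apply: ltn_trans hJ | apply: hact_hf0]. Qed.

Lemma restr_bool b : restr (hf_bool J b) = hf_bool I b.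
Proof.
by case: b; rewrite /= ?restr_hf0 // restr_hfset /= sfresh_hf0 /= restr_hf0.
Qed.

Lemma sfresh_bool b : sfresh (hf_bool J b).
Proof.
by apply: sfresh_invariant => [|g]; [apply: ltn_trans hJ | apply: hact_bool].
Qed.

Lemma exists_fresh3 x y z : hsmall m x -> hsmall m y -> hsmall m z ->
  exists c, [/\ fresh c x, fresh c y & fresh c z].
Proof.
move=> hx hy hz; have [u||c /and4P[]] := @exists_fresh_hsmall _ m [:: x; y; z].
- by rewrite !inE => /or3P[]/eqP->.
- by apply: leq_ltn_trans hm; rewrite /=; lia.
by exists c.
Qed.

Lemma restr_inj x y : hsmall m x -> hsmall m y -> sfresh x -> sfresh y ->
  restr x = restr y -> x = y.
Proof.
elim/hf_ind_mem: x y => [b|x sx IH] y hx hy fx fy e.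
  have := is_set_restr hJ fy; rewrite -e is_set_restr //.
  case: (hf_cases y) e fy => [[b' ->]|->] // e.
  move: fx e {hx}; rewrite !sfresh_atom //; case: b => // a _ + {hy}.
  by case: b' => // a' [->].
have sy : is_set y by rewrite -(is_set_restr hJ fy) -e is_set_restr.
have sub z : z \in elems x -> sfresh z -> z \in elems y.
  move=> zx fz; have : restr z \in elems (restr y).
    by rewrite -e; apply/elems_restrP; exists z.
  case/elems_restrP=> w [wy fw zw]; rewrite (IH z zx w) //.
    exact: hsmall_elem zx.
  exact: hsmall_elem wy.
have sub' z : z \in elems y -> sfresh z -> z \in elems x.
  move=> zy fz; have : restr z \in elems (restr x).
    by rewrite e; apply/elems_restrP; exists z.
  case/elems_restrP=> w [wx fw zw]; rewrite -(IH w wx z) //.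
    exact: hsmall_elem wx.
  exact: hsmall_elem zy.
apply: hf_ext => // z; apply/idP/idP => zx.
  have [c [cx cy cz]] := exists_fresh3 hx hy (hsmall_elem hx zx).
  rewrite -(mem_hact (tperm None c)) (sfresh_fixed cy fy).
  apply: sub; last by rewrite sfresh_hact.
  by rewrite -(sfresh_fixed cx fx) mem_hact.
have [c [cx cy cz]] := exists_fresh3 hx hy (hsmall_elem hy zx).
rewrite -(mem_hact (tperm None c)) (sfresh_fixed cx fx).
apply: sub'; last by rewrite sfresh_hact.
by rewrite -(sfresh_fixed cy fy) mem_hact.
Qed.

Lemma mem_restr x y : hsmall m x -> hsmall m y -> sfresh x ->
  (restr x \in elems (restr y)) = (x \in elems y).
Proof.
move=> hx hy fx; apply/elems_restrP/idP => [[z [zy fz e]]|xy]; last by exists x.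
by rewrite (restr_inj hx (hsmall_elem hy zy) fx fz e).
Qed.

Lemma restr_eq x y : hsmall m x -> hsmall m y -> sfresh x -> sfresh y ->
  (restr x == restr y) = (x == y).
Proof.
by move=> hx hy fx fy; apply/eqP/eqP => [|->//]; apply: restr_inj.
Qed.

Lemma restr_union x : hsmall m x -> sfresh x -> restr (hf_union x) = hf_union (restr x).
Proof.
move=> hx fx; rewrite restr_hfset; apply: eq_hfset => w.
apply/mapP/flatten_mapP => [[z]|[u /elems_restrP[y [yx fy ->]]]].
  rewrite mem_filter => /andP[fz /flatten_mapP[y yx zy]] ->.
  have hy := hsmall_elem hx yx.
  have [c [cx cy cz]] := exists_fresh3 hx hy (hsmall_elem hy zy).
  exists (restr (hact (tperm None c) y)); apply/elems_restrP.
    exists (hact (tperm None c) y); split=> //; last by rewrite sfresh_hact.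
    by rewrite -(sfresh_fixed cx fx) mem_hact.
  by exists z; split=> //; rewrite -(sfresh_fixed cz fz) mem_hact.
case/elems_restrP=> z [zy fz ->]; exists z => //; rewrite mem_filter fz.
by apply/flatten_mapP; exists y.
Qed.

Lemma restr_unique x : hsmall m x -> sfresh x -> sfresh (hf_unique x) ->
  restr (hf_unique x) = hf_unique (restr x).
Proof.
move=> hx fx fu; have [[y e]|e] := hf_uniqueP x.
  move: fu; rewrite e hf_unique_hfset1 => fy.
  by rewrite restr_hfset /= fy hf_unique_hfset1.
rewrite e restr_hf0; have [[w ew]|->//] := hf_uniqueP (restr x).
have /elems_restrP[y [yx fy wy]] : w \in elems (restr x).
  by rewrite ew mem_elems_hfset mem_head.
have hy := hsmall_elem hx yx.
suff ex : x = hfset [:: y].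
  by move: e; rewrite ew wy ex !hf_unique_hfset1 => ->; rewrite restr_hf0.
apply: hf_ext; rewrite ?is_set_hfset //.
  by rewrite -(is_set_restr hJ fx) ew is_set_hfset.
move=> z; rewrite mem_elems_hfset inE; apply/idP/eqP => [zx|->//].
have hz := hsmall_elem hx zx; have [c [cx cy cz]] := exists_fresh3 hx hy hz.
have tzx : hact (tperm None c) z \in elems x.
  by rewrite -(sfresh_fixed cx fx) mem_hact.
have : restr (hact (tperm None c) z) \in elems (restr x).
  by apply/elems_restrP; exists (hact (tperm None c) z); rewrite sfresh_hact.
rewrite ew wy mem_elems_hfset inE restr_eq ?sfresh_hact //; last exact: hsmall_elem tzx.
by rewrite -(inj_eq (@hact_inj _ (tperm None c))) hact_tpermK (sfresh_fixed cy fy) => /eqP.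
Qed.

Lemma restr_pair x y : sfresh x -> sfresh y ->
  restr (hf_pair x y) = hf_pair (restr x) (restr y).
Proof. by move=> fx fy; rewrite restr_hfset /= fx fy. Qed.

Lemma restr_Atoms : restr (hf_Atoms J) = hf_Atoms I.
Proof.
rewrite restr_hfset; apply: eq_hfset => w; apply/mapP/mapP => [[x]|[a _ ->]].
  rewrite mem_filter => /andP[fx /mapP[b _ e]] ->; move: fx; rewrite e sfresh_atom //.
  by case: b e => // a e _; exists a; rewrite ?mem_enum.
by exists (atom (Some a)); rewrite // mem_filter sfresh_atom // map_f ?mem_enum.
Qed.

Lemma restr_atomP x a : sfresh x -> restr x = atom a -> x = atom (Some a).
Proof.
move=> fx e; have := is_set_restr hJ fx; rewrite e.
case: (hf_cases x) e fx => [[b ->]|->//]; rewrite sfresh_atom //.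
by case: b => // a' [->].
Qed.

End Small.

End Restriction.

(** * Simulation *)

Definition interpretation (V : vocabulary) (I : Type) :=
  forall R : rel_sym V, (rel_arity R).-tuple I -> bool.

Section Simulation.
Variable V : vocabulary.

(* [sB] is related to [sA] only at locations with arguments in the domain where
   [restr] is injective. *)
Definition simulates k M (I : finType) (iA : interpretation V I)
    (iB : interpretation V (option I))
    (sA : state (Structure iA)) (sB : state (Structure iB)) :=
  [/\ small_state k sB,
      forall R a, iB R (map_tuple Some a) = iA R a,
      M <= #|{: option I}| &
      forall f (xs : seq (hf (option I))),
        all (@sfresh I) xs -> (forall x, x \in xs -> hsmall M x) ->
        sA (f, map (@restr I) xs) = restr (sB (f, xs))].

Definition env_restr m (I : finType) n
    (envA : 'I_n -> hf I) (envB : 'I_n -> hf (option I)) :=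
  forall i, [/\ hsmall m (envB i), sfresh (envB i) & envA i = restr (envB i)].

Definition restr_update (I : finType) (u : bool * nat * seq (hf (option I)) * hf (option I)) :=
  (u.1.1, map (@restr I) u.1.2, restr u.2).

Lemma env_restr_push m m' (I : finType) (iA : interpretation V I)
    (iB : interpretation V (option I)) n (envA : 'I_n -> hf I)
    (envB : 'I_n -> hf (option I)) x :
  env_restr m envA envB -> m <= m' -> hsmall m' x -> sfresh x ->
  env_restr m' (push (A := Structure iA) (restr x) envA)
    (push (A := Structure iB) x envB).
Proof.
move=> he mm hx fx i; rewrite /push; case: unliftP => [j _|_] //=.
by have [h1 h2 h3] := he j; split=> //; apply: hsmallW h1.
Qed.

Lemma teval_sfresh n (t : term V n) k m : exists K, forall M (I : finType)
    (iA : interpretation V I) (iB : interpretation V (option I))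
    (sA : state (Structure iA)) (sB : state (Structure iB)) envA envB,
    simulates k M sA sB -> K <= M -> env_restr m envA envB ->
  hsmall K (teval sB t envB) /\ sfresh (teval sB t envB).
Proof.
have [K hK] := teval_hsmall t k m; exists (K + (n * m).*2.+1).
move=> M I iA iB sA sB envA envB [hs _ hM _] KM he.
have hJ := leq_trans KM hM; have he' i : hsmall m (envB i) by case: (he i).
split; last first.
  apply: (fresh_teval hs t he') => [|i]; last by case: (he i).
  by apply: leq_trans hJ; rewrite leq_addl.
apply: hsmallW (leq_addr _ _) _; apply: hK => //.
by apply: leq_trans hJ; rewrite leq_addr.
Qed.

(* Any element of [X] is moved away from [None] by exchanging [None] for an atom
   fresh for all the objects involved, which fixes those not depending on [None]. *)
Lemma star_move K (I : finType) (iB : interpretation V (option I)) n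
    (envB : 'I_n -> hf (option I)) (X z : hf (option I)) (ys : seq (hf (option I))) :
    (forall i, hsmall K (envB i)) -> (forall i, sfresh (envB i)) ->
    hsmall K X -> sfresh X -> z \in elems X -> (forall y, y \in ys -> hsmall K y) ->
    (n + 2 + size ys) * K < #|{: option I}| ->
  exists g : {perm option I},
    [/\ hact g z \in elems X, sfresh (hact g z),
        forall i, push (A := Structure iB) (hact g z) envB i =
          hact g (push (A := Structure iB) z envB i)
      & forall y, y \in ys -> sfresh (hact g y) /\ (sfresh y -> hact g y = y)].
Proof.
move=> he fe hX fX zX hy hJ.
have hz := hsmall_elem hX zX.
have [y||c] := @exists_fresh_hsmall _ K (X :: z :: [seq envB i | i : 'I_n] ++ ys).
- by rewrite !inE mem_cat => /or4P[/eqP->|/eqP->|/mapP[i _ ->]|/hy] //.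
- apply: leq_ltn_trans hJ; rewrite /= size_cat size_map -cardE card_ord.
  by rewrite addnAC addn2.
rewrite /= all_cat => /and4P[cX cz /allP ce /allP cy]; exists (tperm None c).
split.
- by rewrite -(sfresh_fixed cX fX) mem_hact.
- by rewrite sfresh_hact.
- move=> i; rewrite /push; case: unliftP => [j _|_] //=.
  rewrite (@sfresh_fixed _ c (envB j)) //.
  by apply: ce; rewrite map_f ?mem_enum.
- move=> y /cy fy; rewrite sfresh_hact; split=> //.
  exact: sfresh_fixed.
Qed.

Lemma all_isSome_tuple (I : finType) j (a : j.-tuple (option I)) :
  all isSome a -> exists a' : j.-tuple I, a = map_tuple Some a'.
Proof.
move=> ha; have e : map Some (pmap id a) = a.
  by elim: (tval a) ha => //= -[b|] // s IH /IH e; rewrite /= e.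
have sa : size (pmap id a) == j by rewrite -(size_map Some) e size_tuple.
by exists (Tuple sa); apply: val_inj; rewrite /= e.
Qed.

Lemma eq_map_atom_restr (I : finType) m (us : seq (hf (option I))) (a : seq I) :
    3 * m.+1 < #|{: option I}| -> all (@sfresh I) us ->
  (map (@restr I) us == map (@atom I) a) = (us == map (@atom _) (map Some a)).
Proof.
move=> hJ; elim: us a => [|u us IH] [|b a] //= /andP[fu fus].
rewrite !eqseq_cons IH //; congr andb; apply/eqP/eqP => [|->//].
exact: restr_atomP hJ _ _ _.
Qed.

Definition teval_restr n (t : term V n) k m N := forall M (I : finType)
     (iA : interpretation V I) (iB : interpretation V (option I))
     (sA : state (Structure iA)) (sB : state (Structure iB)) envA envB,
   simulates k M sA sB -> N <= M -> env_restr m envA envB ->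
   teval sA t envA = restr (teval sB t envB).

Definition feval_restr n (phi : formula V n) k m N := forall M (I : finType)
     (iA : interpretation V I) (iB : interpretation V (option I))
     (sA : state (Structure iA)) (sB : state (Structure iB)) envA envB,
   simulates k M sA sB -> N <= M -> env_restr m envA envB ->
   feval sA phi envA = feval sB phi envB.

Lemma args_restr n j (args : 'I_j -> term V n) k m :
    (forall i, exists N, teval_restr (args i) k m N) ->
  exists N, forall M (I : finType)
     (iA : interpretation V I) (iB : interpretation V (option I))
     (sA : state (Structure iA)) (sB : state (Structure iB)) envA envB,
   simulates k M sA sB -> N <= M -> env_restr m envA envB ->
   [/\ [seq teval sA (args i) envA | i : 'I_j] =
         map (@restr I) [seq teval sB (args i) envB | i : 'I_j],
       all (@sfresh I) [seq teval sB (args i) envB | i : 'I_j]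
     & forall x, x \in [seq teval sB (args i) envB | i : 'I_j] -> hsmall N x].
Proof.
move=> IH; have [N hN] : exists N, forall i, teval_restr (args i) k m N.
  apply: fin_leq_bound IH _ => i N N' NN hN M I iA iB sA sB envA envB sim NM he.
  exact: hN sim (leq_trans NN NM) he.
have [K hK] := fin_all_exists (fun i => teval_sfresh (args i) k m).
have KK i : K i <= \max_i K i by apply: leq_bigmax.
exists (N + \max_i K i) => M I iA iB sA sB envA envB sim NM he.
have hK' i : hsmall (K i) (teval sB (args i) envB) /\ sfresh (teval sB (args i) envB).
  by apply: hK sim _ he; apply: leq_trans NM; apply: leq_trans (KK i) (leq_addl _ _).
split.
- rewrite -map_comp; apply: eq_map => i /=; apply: hN sim _ he.
  by apply: leq_trans NM; apply: leq_addr.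
- by apply/allP => _ /mapP[i _ ->]; case: (hK' i).
- move=> _ /mapP[i _ ->]; apply: hsmallW (hK' i).1.
  exact: leq_trans (KK i) (leq_addl _ _).
Qed.

Lemma eval_restr :
  (forall n (t : term V n) k m, exists N, teval_restr t k m N) /\
  (forall n (phi : formula V n) k m, exists N, feval_restr phi k m N).
Proof.
apply: (term_formula_ind
  (P := fun n (t : term V n) => forall k m, exists N, teval_restr t k m N)
  (P0 := fun n (phi : formula V n) => forall k m, exists N, feval_restr phi k m N)).
- by move=> n v k m; exists 0 => M I iA iB sA sB envA envB _ _ /(_ v)[].
- move=> n phi IH k m; have [N hN] := IH k m; exists (N + 5).
  move=> M I iA iB sA sB envA envB sim NM he /=.
  rewrite (hN _ _ _ _ _ _ _ _ sim _ he) // ?(@restr_bool _ 0) //; last lia.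
  by case: sim => _ _ hM _; apply: leq_trans hM; lia.
- by move=> n k m; exists 0 => M I iA iB sA sB envA envB _ _ _ /=; rewrite restr_hf0.
- move=> n k m; exists 5 => M I iA iB sA sB envA envB [_ _ hM _] NM _ /=.
  by rewrite (@restr_Atoms _ 0) //; apply: leq_trans hM; lia.
- move=> n t IH k m; have [N hN] := IH k m; have [K hK] := teval_sfresh t k m.
  exists (N + 4 * K + 5) => M I iA iB sA sB envA envB sim NM he /=.
  rewrite (hN _ _ _ _ _ _ _ _ sim _ he) //; last lia.
  have [|ht ft] := hK _ _ _ _ _ _ _ _ sim _ he; first lia.
  rewrite (@restr_union _ K) //; case: sim => _ _ hM _; apply: leq_trans hM; lia.
- move=> n t IH k m; have [N hN] := IH k m; have [K hK] := teval_sfresh t k m.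
  have [K' hK'] := teval_sfresh (TTheUnique t) k m.
  exists (N + 4 * K + K' + 5) => M I iA iB sA sB envA envB sim NM he /=.
  rewrite (hN _ _ _ _ _ _ _ _ sim _ he) //; last lia.
  have [|ht ft] := hK _ _ _ _ _ _ _ _ sim _ he; first lia.
  have [|_ fu] := hK' _ _ _ _ _ _ _ _ sim _ he; first lia.
  rewrite (@restr_unique _ K) //; case: sim => _ _ hM _; apply: leq_trans hM; lia.
- move=> n t IHt u IHu k m; have [N hN] := IHt k m; have [N' hN'] := IHu k m.
  have [K hK] := teval_sfresh t k m; have [K' hK'] := teval_sfresh u k m.
  exists (N + N' + K + K') => M I iA iB sA sB envA envB sim NM he /=.
  rewrite (hN _ _ _ _ _ _ _ _ sim _ he) ?(hN' _ _ _ _ _ _ _ _ sim _ he) //; try lia.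
  have [|_ ft] := hK _ _ _ _ _ _ _ _ sim _ he; first lia.
  have [|_ fu] := hK' _ _ _ _ _ _ _ _ sim _ he; first lia.
  by rewrite restr_pair.
- move=> n j f args IH k m; have [i|N hN] := @args_restr _ _ args k m; first exact: IH.
  exists N => M I iA iB sA sB envA envB sim NM he /=.
  have [-> fu hu] := hN _ _ _ _ _ _ _ _ sim NM he; case: sim => _ _ _; apply=> //.
  by move=> x /hu; apply: hsmallW.
- move=> n t IHt r IHr phi IHp k m.
  have [Nr hNr] := IHr k m; have [Kr hKr] := teval_sfresh r k m.
  have [Nt hNt] := IHt k (maxn m Kr); have [Kt hKt] := teval_hsmall t k (maxn m Kr).
  have [Np hNp] := IHp k (maxn m Kr); have [Kt' hKt'] := teval_sfresh t k (maxn m Kr).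
  pose K := maxn (maxn m Kr) Kt.
  exists (Nr + Kr + Nt + Kt + Np + Kt' + ((n + 2 + 1) * K).+1).
  move=> M I iA iB sA sB envA envB sim NM he /=.
  have [hs _ hM _] := sim; have [symB eqB _] := hs.
  have [|hr fr] := hKr _ _ _ _ _ _ _ _ sim _ he; first lia.
  have er : teval sA r envA = restr (teval sB r envB).
    by apply: hNr sim _ he; lia.
  have push_ok z : z \in elems (teval sB r envB) -> sfresh z ->
      env_restr (maxn m Kr) (push (A := Structure iA) (restr z) envA)
        (push (A := Structure iB) z envB).
    move=> zr fz; apply: env_restr_push he (leq_maxl _ _) _ fz.
    exact: hsmallW (leq_maxr _ _) (hsmall_elem hr zr).
  have et z : z \in elems (teval sB r envB) -> sfresh z ->
      teval sA t (push (A := Structure iA) (restr z) envA) =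
      restr (teval sB t (push (A := Structure iB) z envB)).
    by move=> zr fz; apply: hNt sim _ (push_ok z zr fz); lia.
  have ep z : z \in elems (teval sB r envB) -> sfresh z ->
      feval sA phi (push (A := Structure iA) (restr z) envA) =
      feval sB phi (push (A := Structure iB) z envB).
    by move=> zr fz; apply: hNp sim _ (push_ok z zr fz); lia.
  rewrite er restr_hfset; apply: eq_hfset => w; apply/mapP/mapP.
    case=> x; rewrite mem_filter => /andP[px /elems_restrP[z [zr fz xz]]].
    rewrite xz ep // in px * => ->; exists (teval sB t (push (A := Structure iB) z envB)).
      rewrite mem_filter; apply/andP; split; last by rewrite map_f // mem_filter px.
      by case: (hKt' _ _ _ _ _ _ _ _ sim _ (push_ok z zr fz)) => //; lia.
    exact: et.
  case=> y; rewrite mem_filter => /andP[fy /mapP[z]].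
  rewrite mem_filter => /andP[pz zr] yz ->.
  have hz i : hsmall (maxn m Kr) (push (A := Structure iB) z envB i).
    apply: hsmall_push => [|{}i].
      exact: hsmallW (leq_maxr _ _) (hsmall_elem hr zr).
    by case: (he i) => h _ _; apply: hsmallW h; apply: leq_maxl.
  have hy : hsmall Kt y by rewrite yz; apply: (hKt _ _ _ hs _ hz); apply: leq_trans hM; lia.
  have [|||||g [gr fg eg /(_ y)]] :=
      @star_move K I iB n envB (teval sB r envB) z [:: y] _ _ _ fr zr.
  - by move=> i; case: (he i) => h _ _; apply: hsmallW h; lia.
  - by move=> i; case: (he i).
  - by apply: hsmallW hr; lia.
  - by move=> u; rewrite inE => /eqP->; apply: hsmallW hy; lia.
  - by apply: leq_trans hM; rewrite /=; lia.
  rewrite inE eqxx => /(_ isT)[_ /(_ fy) gy].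
  have [gt gf] := eval_hact symB eqB g.
  exists (restr (hact g z)).
    rewrite mem_filter ep // (gf _ _ _ _ eg) pz /=.
    by apply/elems_restrP; exists (hact g z).
  by rewrite et // (gt _ _ _ _ eg) -yz gy.
- by move=> n k m; exists 0.
- by move=> n k m; exists 0.
- move=> n phi IH k m; have [N hN] := IH k m; exists N.
  by move=> M I iA iB sA sB envA envB sim NM he /=; rewrite (hN _ _ _ _ _ _ _ _ sim _ he).
- move=> n phi IH psi IH' k m; have [N hN] := IH k m; have [N' hN'] := IH' k m.
  exists (N + N') => M I iA iB sA sB envA envB sim NM he /=.
  by rewrite (hN _ _ _ _ _ _ _ _ sim _ he) ?(hN' _ _ _ _ _ _ _ _ sim _ he) //; lia.
- move=> n phi IH psi IH' k m; have [N hN] := IH k m; have [N' hN'] := IH' k m.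
  exists (N + N') => M I iA iB sA sB envA envB sim NM he /=.
  by rewrite (hN _ _ _ _ _ _ _ _ sim _ he) ?(hN' _ _ _ _ _ _ _ _ sim _ he) //; lia.
- move=> n t IHt u IHu k m; have [N hN] := IHt k m; have [N' hN'] := IHu k m.
  have [K hK] := teval_sfresh t k m; have [K' hK'] := teval_sfresh u k m.
  exists (N + N' + 4 * K + 4 * K' + 5) => M I iA iB sA sB envA envB sim NM he /=.
  rewrite (hN _ _ _ _ _ _ _ _ sim _ he) ?(hN' _ _ _ _ _ _ _ _ sim _ he) //; try lia.
  have [|ht ft] := hK _ _ _ _ _ _ _ _ sim _ he; first lia.
  have [|hu fu] := hK' _ _ _ _ _ _ _ _ sim _ he; first lia.
  apply: (@restr_eq _ (maxn K K')) => //.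
  - by case: sim => _ _ hM _; apply: leq_trans hM; lia.
  - by apply: hsmallW ht; apply: leq_maxl.
  - by apply: hsmallW hu; apply: leq_maxr.
- move=> n t IHt u IHu k m; have [N hN] := IHt k m; have [N' hN'] := IHu k m.
  have [K hK] := teval_sfresh t k m; have [K' hK'] := teval_sfresh u k m.
  exists (N + N' + 4 * K + 4 * K' + 5) => M I iA iB sA sB envA envB sim NM he /=.
  rewrite (hN _ _ _ _ _ _ _ _ sim _ he) ?(hN' _ _ _ _ _ _ _ _ sim _ he) //; try lia.
  have [|ht ft] := hK _ _ _ _ _ _ _ _ sim _ he; first lia.
  have [|hu fu] := hK' _ _ _ _ _ _ _ _ sim _ he; first lia.
  apply: (@mem_restr _ (maxn K K')) => //.
  - by case: sim => _ _ hM _; apply: leq_trans hM; lia.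
  - by apply: hsmallW ht; apply: leq_maxl.
  - by apply: hsmallW hu; apply: leq_maxr.
- move=> n R args IH k m; have [i|N hN] := @args_restr _ _ args k m; first exact: IH.
  exists (N + 4) => M I iA iB sA sB envA envB sim NM he /=.
  have [|-> fu hu] := hN _ _ _ _ _ _ _ _ sim _ he; first lia.
  case: sim => _ ext hM _; set us := [seq teval sB _ _ | i : _] in fu hu *.
  have hJ : 3 * 1 < #|{: option I}| by apply: leq_trans hM; lia.
  apply/existsP/existsP => -[a /andP[ua ia]].
    exists (map_tuple Some a); rewrite /= in ia *; rewrite ext ia andbT.
    by rewrite -(eq_map_atom_restr _ hJ).
  have hat : all isSome a.
    apply/allP => b ba; have /(allP fu) : atom b \in us by rewrite (eqP ua) map_f.
    rewrite (@sfresh_atom I b); first by case: b {ba}.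
    by apply: leq_trans hM; lia.
  have [a' ea] := all_isSome_tuple hat; exists a'.
  by rewrite (eq_map_atom_restr _ hJ) // -ext -ea ia andbT (eqP ua) ea.
- move=> n j f args IH k m; have [i|N hN] := @args_restr _ _ args k m; first exact: IH.
  exists (N + (j + 1) * (N + k) + 3 * k.+1 + 1) => M I iA iB sA sB envA envB sim NM he /=.
  have [|-> fu hu] := hN _ _ _ _ _ _ _ _ sim _ he; first lia.
  have [[_ eqB hk] _ hM rel] := sim; set us := [seq teval sB _ _ | i : _] in fu hu *.
  have su : size us = j by rewrite size_map -cardE card_ord.
  rewrite rel //; last by move=> x /hu; apply: hsmallW; lia.
  have hJ : 3 * k.+1 < #|{: option I}| by apply: leq_trans hM; lia.
  rewrite -[hfset [:: hf0 I]]/(hf_bool I true) -[hfset [:: hf0 _]]/(hf_bool (option I) true).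
  rewrite -(restr_bool hJ true) (restr_eq hJ) //.
  - by apply: hsmall_bool; apply: leq_trans hJ.
  - have [x||c /= /andP[cs /allP cu]] := @exists_fresh_hsmall _ (N + k) (sB (true, f, us) :: us).
    + rewrite inE => /orP[/eqP->|/hu]; last by apply: hsmallW; apply: leq_addr.
      by apply: hsmallW (hk _); apply: leq_addl.
    + by rewrite /= su; apply: leq_trans hM; lia.
    have e := eqB (tperm None c) (true, f, us).
    rewrite -(sfresh_hact c) -e /lact /= map_id_in // in cs.
    by move=> x xu; apply: sfresh_fixed (cu x xu) _; apply: (allP fu).
  - exact: sfresh_bool hJ _.
Qed.

Definition sfresh_update (I : finType)
    (v : bool * nat * seq (hf (option I)) * hf (option I)) :=
  all (@sfresh I) v.1.2 && sfresh v.2.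

Lemma updates_restr n (R : rule V n) k m : exists N, forall M (I : finType)
    (iA : interpretation V I) (iB : interpretation V (option I))
    (sA : state (Structure iA)) (sB : state (Structure iB)) envA envB,
   simulates k M sA sB -> N <= M -> env_restr m envA envB ->
 forall u, u \in updates sA R envA <->
   exists2 v, v \in updates sB R envB & sfresh_update v /\ u = restr_update v.
Proof.
have [teR feR] := eval_restr.
elim: R m => {n} [n|n j f args t|n j f args phi|n phi R0 IH0 R1 IH1|n r R0 IH] m.
- by exists 0 => M I iA iB sA sB envA envB _ _ _ u /=; split=> [|[]].
- have [i|N hN] := @args_restr _ _ args k m; first exact: teR.
  have [N' hN'] := teR _ t k m; have [K hK] := teval_sfresh t k m.
  exists (N + N' + K) => M I iA iB sA sB envA envB sim NM he u /=.
  have [|-> fu _] := hN _ _ _ _ _ _ _ _ sim _ he; first lia.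
  rewrite (hN' _ _ _ _ _ _ _ _ sim _ he); last lia.
  have [|_ ft] := hK _ _ _ _ _ _ _ _ sim _ he; first lia.
  rewrite inE; split=> [/eqP->|[v]].
    by eexists; [exact: mem_head | split=> //; rewrite /sfresh_update /= fu].
  by rewrite inE => /eqP-> [_ ->].
- have [i|N hN] := @args_restr _ _ args k m; first exact: teR.
  have [N' hN'] := feR _ phi k m.
  exists (N + N' + 4) => M I iA iB sA sB envA envB sim NM he u /=.
  have [|-> fu _] := hN _ _ _ _ _ _ _ _ sim _ he; first lia.
  rewrite (hN' _ _ _ _ _ _ _ _ sim _ he); last lia.
  have hJ : 3 * 1 < #|{: option I}|.
    by case: sim => _ _ hM _; apply: leq_trans hM; lia.
  rewrite inE -(restr_bool hJ); split=> [/eqP->|[v]].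
    eexists; [exact: mem_head | split=> //].
    by rewrite /sfresh_update /= fu (sfresh_bool hJ).
  by rewrite inE => /eqP-> [_ ->].
- have [N hN] := IH0 m; have [N' hN'] := IH1 m; have [K hK] := feR _ phi k m.
  exists (N + N' + K) => M I iA iB sA sB envA envB sim NM he u /=.
  rewrite (hK _ _ _ _ _ _ _ _ sim _ he); last lia.
  by case: ifP => _; [apply: hN sim _ he u; lia | apply: hN' sim _ he u; lia].
have [Nr hNr] := teR _ r k m; have [Kr hKr] := teval_sfresh r k m.
have [N hN] := IH (maxn m Kr); have [Ku hKu] := updates_hsmall R0 k (maxn m Kr).
pose K := maxn (maxn m Kr) Ku.
exists (Nr + Kr + N + Ku + ((n + 2 + Ku.+1) * K).+1).
move=> M I iA iB sA sB envA envB sim NM he u /=.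
have [hs _ hM _] := sim; have [symB eqB _] := hs.
have [|hr fr] := hKr _ _ _ _ _ _ _ _ sim _ he; first lia.
have er : teval sA r envA = restr (teval sB r envB).
  by apply: hNr sim _ he; lia.
have push_ok z : z \in elems (teval sB r envB) -> sfresh z ->
    env_restr (maxn m Kr) (push (A := Structure iA) (restr z) envA)
      (push (A := Structure iB) z envB).
  move=> zr fz; apply: env_restr_push he (leq_maxl _ _) _ fz.
  exact: hsmallW (leq_maxr _ _) (hsmall_elem hr zr).
have eR z : z \in elems (teval sB r envB) -> sfresh z -> forall u,
    u \in updates sA R0 (push (A := Structure iA) (restr z) envA) <->
    exists2 v, v \in updates sB R0 (push (A := Structure iB) z envB) &
      sfresh_update v /\ u = restr_update v.
  by move=> zr fz; apply: hN sim _ (push_ok z zr fz); lia.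
rewrite er; split.
  case/flatten_mapP=> x /elems_restrP[z [zr fz ->]] /(eR z zr fz)[v vR hv].
  by exists v => //; apply/flatten_mapP; exists z.
case=> v /flatten_mapP[z zr vR] [/andP[fxs fx] uv].
have hz i : hsmall (maxn m Kr) (push (A := Structure iB) z envB i).
  apply: hsmall_push => [|{}i].
    exact: hsmallW (leq_maxr _ _) (hsmall_elem hr zr).
  by case: (he i) => h _ _; apply: hsmallW h; apply: leq_maxl.
have [sv hxs hx] : small_update Ku v.
  by apply: (hKu _ _ _ _ hs _ hz vR); apply: leq_trans hM; lia.
have [|||||g [gr fg eg hg]] :=
    @star_move K I iB n envB (teval sB r envB) z (v.2 :: v.1.2) _ _ _ fr zr.
- by move=> i; case: (he i) => h _ _; apply: hsmallW h; lia.
- by move=> i; case: (he i).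
- by apply: hsmallW hr; lia.
- by move=> y; rewrite inE => /orP[/eqP->|/hxs hy];
    [apply: hsmallW hx | apply: hsmallW hy]; lia.
- apply: leq_trans hM; apply: leq_trans NM.
  apply: (@leq_trans ((n + 2 + Ku.+1) * K).+1); last lia.
  by rewrite ltnS leq_mul2r leq_add2l /= ltnS sv orbT.
apply/flatten_mapP; exists (restr (hact g z)).
  by apply/elems_restrP; exists (hact g z).
apply/(eR _ gr fg); exists v; last by rewrite /sfresh_update fxs fx.
have := updates_hact symB eqB eg vR.
rewrite /lact map_id_in => [|y yv]; last first.
  by have [|_ ->] := hg y; rewrite ?inE ?yv ?orbT // (allP fxs).
have [|_ ->] := hg v.2; rewrite ?mem_head //.
by rewrite -!surjective_pairing.
Qed.

Lemma consistentP (B : structure V) (U : seq (location B * hf B)) :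
  reflect (forall l x y, (l, x) \in U -> (l, y) \in U -> x = y) (consistent U).
Proof.
apply: (iffP allP) => [h l x y lx ly|h [l x] lx].
  by have /allP/(_ _ ly)/= := h _ lx; rewrite eqxx => /eqP.
by apply/allP => -[l' y] ly /=; apply/implyP => /eqP ll; rewrite (h l x y) // ll.
Qed.

Lemma map_restr_inj (I : finType) m (xs ys : seq (hf (option I))) :
    3 * m.+1 < #|{: option I}| ->
    (forall x, x \in xs -> hsmall m x) -> (forall x, x \in ys -> hsmall m x) ->
    all (@sfresh I) xs -> all (@sfresh I) ys ->
  map (@restr I) xs = map (@restr I) ys -> xs = ys.
Proof.
move=> hJ; elim: xs ys => [|x xs IH] [|y ys] //= hx hy /andP[fx fxs] /andP[fy fys].
case=> e es; congr (_ :: _).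
  by apply: (restr_inj hJ) e => //; [apply: hx | apply: hy]; apply: mem_head.
by apply: IH => // z zs; [apply: hx | apply: hy]; rewrite inE zs orbT.
Qed.

Lemma step_restr (P : program V) k : exists N, forall M (I : finType)
    (iA : interpretation V I) (iB : interpretation V (option I))
    (sA : state (Structure iA)) (sB : state (Structure iB)),
   simulates k M sA sB -> N <= M -> 4 * M + 4 < #|{: option I}| ->
 forall f (xs : seq (hf (option I))),
   all (@sfresh I) xs -> (forall x, x \in xs -> hsmall M x) ->
 step P sA (f, map (@restr I) xs) = restr (step P sB (f, xs)).
Proof.
have [N hN] := updates_restr P k 0; have [K hK] := updates_hsmall P k 0.
exists (N + K + (K + 2) * K + 1).
move=> M I iA iB sA sB sim NM hJM f xs fxs hxs.
have hJ : 3 * M.+1 < #|{: option I}| by apply: leq_ltn_trans hJM; lia.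
have [hs _ hM rel] := sim; have [symB eqB hk] := hs.
have KM : K <= M by lia.
have cJ : (K + 2) * K < #|{: option I}| by apply: leq_trans hM; lia.
rewrite /step; set UA := updates _ _ _; set UB := updates _ _ _.
have eU u : u \in UA <-> exists2 v, v \in UB & sfresh_update v /\ u = restr_update v.
  by apply: hN sim _ _ u; [lia | case].
have sU v : v \in UB -> small_update K v.
  apply: hK hs _ _; last by case.
  by apply: leq_trans hM.
have smallM v : v \in UB -> (forall x, x \in v.1.2 -> hsmall M x) /\ hsmall M v.2.
  case/sU=> _ h1 h2; split=> [x /h1 h3|]; [exact (hsmallW KM h3) | exact (hsmallW KM h2)].
have gU (g : {perm option I}) l x : (l, x) \in UB ->
    (lact (B := Structure iB) g l, hact g x) \in UB.
  by move/(updates_hact symB eqB (g := g)); apply; case.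
have cU : consistent UA = consistent UB.
  apply/consistentP/consistentP => [h l x y lx ly|h l x y].
    have [sl hl hx] := sU _ lx; have [_ _ hy] := sU _ ly.
    have [z||c /and3P[cx cy /allP cl]] := @exists_fresh_hsmall _ K (x :: y :: l.2).
    - by rewrite !inE => /or3P[/eqP->|/eqP->|/hl].
    - by apply: leq_ltn_trans cJ; rewrite leq_mul2r /= -addn2 leq_add2r sl orbT.
    pose g := tperm None c; have gx := gU g _ _ lx; have gy := gU g _ _ ly.
    have fl : all (@sfresh I) (map (hact g) l.2).
      by apply/allP => _ /mapP[z zl ->]; rewrite sfresh_hact cl.
    have fx : sfresh (hact g x) by rewrite sfresh_hact.
    have fy : sfresh (hact g y) by rewrite sfresh_hact.
    have [_ hgx] := smallM _ gx; have [_ hgy] := smallM _ gy.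
    apply: (@hact_inj _ g); apply: (restr_inj hJ) => //.
    apply: (h (l.1, map (@restr I) (map (hact g) l.2))).
      by apply/eU; exists (lact (B := Structure iB) g l, hact g x); rewrite // /sfresh_update /= fl fx.
    by apply/eU; exists (lact (B := Structure iB) g l, hact g y); rewrite // /sfresh_update /= fl fy.
  case/eU=> -[[f1 l1] x1] v1 [/andP[fl1 fx1] [e1 ->]].
  case/eU=> -[[f2 l2] x2] v2 [/andP[fl2 fx2] [e2 ->]].
  move: e2; rewrite e1 => -[e2 e3].
  have /= ee := map_restr_inj hJ (smallM _ v1).1 (smallM _ v2).1 fl1 fl2 e3.
  move: v2; rewrite -ee -[f2]e2 => v2; congr restr; exact: h v1 v2.
rewrite cU; case: ifP => cB; last exact: rel.
have cA := cU; rewrite cB in cA.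
have [[x lx ->]|[nl ->]] := fireP sB (f, xs) cB.
  have [sl hl hx] := sU _ lx.
  have [z||c /= /andP[cx /allP cl]] := @exists_fresh_hsmall _ K (x :: xs).
  - by rewrite inE => /orP[/eqP->|/hl].
  - apply: leq_ltn_trans cJ; rewrite leq_mul2r; apply/orP; right.
    by rewrite addn2 ltnW //= !ltnS.
  have gx := gU (tperm None c) _ _ lx.
  have el : lact (B := Structure iB) (tperm None c) (f, xs) = (f, xs).
    rewrite /lact /= map_id_in // => z zx; apply: sfresh_fixed (cl z zx) _.
    exact: (allP fxs).
  have fx : sfresh x.
    rewrite el in gx; rewrite -((consistentP _ cB) _ _ _ gx lx).
    by rewrite sfresh_hact.
  apply: (@fire_mem _ (Structure iA) UA sA _ _ cA); apply/eU; exists ((f, xs), x) => //.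
  by rewrite /sfresh_update /= fxs fx.
have [[y ly _]|[_ ->]] := fireP sA (f, map (@restr I) xs) cA; last exact: rel.
move: ly => /eU[[[f' xs'] x] v [/andP[fl _] [ef el _]]].
have e := map_restr_inj hJ hxs (smallM _ v).1 fxs fl el.
by have := nl x; rewrite ef e v.
Qed.

End Simulation.

Lemma active_bound0 (V : vocabulary) (B : structure V) P k m j :
  active_bound B P k m -> j <= k ->
  exists2 S : seq (hf B), size S <= m & forall x, active (run B P j) x -> x \in S.
Proof. by case=> S sS hS jk; exists S => // x; apply: hS. Qed.

Lemma decides_within_agree (V : vocabulary) (P : program V) p q (Q : query V) :
    decides_within P p q Q ->
  exists N, forall (I : finType) (iA : interpretation V I)
    (iB : interpretation V (option I)), N <= #|I| ->
    symmetric_structure (Structure iB) ->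
    (forall R a, iB R (map_tuple Some a) = iA R a) ->
  Q (Structure iA) <-> Q (Structure iB).
Proof.
move=> dP; have [K [Nq hq]] := poly_thresholds q.
have [N hN] := step_restr P K; pose M := N + K.
exists (Nq + 4 * M + 6) => I iA iB nI symB ext.
set A := Structure iA; set B := Structure iB.
have cJ : #|{: option I}| = #|I|.+1 by rewrite card_option.
have hJM : 4 * M + 4 < #|{: option I}| by rewrite cJ; lia.
have hJ : 3 * K.+1 < #|{: option I}| by rewrite cJ; lia.
have [|K0 [r [h1 h2 h3]]] := hq #|B|; first by rewrite [#|_|]cJ; lia.
have [kA [_ haltA noA _ outA]] := dP A; have [kB [_ haltB noB bB outB]] := dP B.
have sim j : j <= kB -> simulates K M (run A P j) (run B P j).
  elim: j => [|j IH] jk.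
    split=> [|||f xs _ _]; rewrite ?restr_hf0 //; last by rewrite cJ; lia.
    split=> [//|g l|l]; first exact/esym/hact_hf0.
    by apply: hsmall_hf0; rewrite [#|_|]cJ.
  have {}IH := IH (ltnW jk); split=> //; last first.
  - by move=> f xs fxs hxs; apply: hN IH _ hJM f xs fxs hxs; apply: leq_addr.
  - by rewrite cJ; lia.
  split=> // [|l]; first exact: run_equivariant.
  have [S sS hS] := active_bound0 bB jk.
  apply: (active_hsmall (r := r) _ hS) => //; first exact: run_equivariant.
    exact: leq_ltn_trans sS h1.
  exact: leq_ltn_trans sS h3.
have agree j f : j <= kB ->
    (run A P j (true, f, [::]) == hf_bool I true) =
    (run B P j (true, f, [::]) == hf_bool (option I) true).
  move=> jk; have [[_ eqB hB] _ _ rel] := sim j jk.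
  rewrite (rel (true, f) [::]) // -(restr_bool hJ true).
  apply: (restr_eq hJ); [exact: hB | | | exact: sfresh_bool hJ _].
    by apply: hsmall_bool; apply: leq_trans hJ.
  apply: sfresh_invariant => [|g]; first exact: leq_trans hJ.
  exact/esym/(eqB g (true, f, [::])).
have kAB : kA = kB.
  apply/eqP; rewrite eqn_leq; apply/andP; split; rewrite leqNgt; apply/negP => lt.
    by have := noA _ lt; rewrite /Halt agree // -/(Halt _) haltB.
  by have := noB _ lt; rewrite /Halt -agree ?(ltnW lt) // -/(Halt _) haltA.
rewrite -outA -outB kAB /Output; split; by rewrite agree.
Qed.

(** * Complete graphs *)

Import GRing.Theory.

(* [a] always has two entries. *)
Definition complete (T : finType) : interpretation digraph_voc T :=
  fun _ a => if tval a is [:: x; y] then x != y else false.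

Lemma complete_map (T U : finType) (f : T -> U) R (a : (rel_arity R).-tuple T) :
  injective f -> complete (map_tuple f a) = complete a.
Proof.
rewrite /complete /= => fi; case: (tval a) => [|x [|y [|z s]]] //=.
by rewrite (inj_eq fi).
Qed.

Section Determinant.
Local Open Scope ring_scope.

Lemma natr_F2 n : n%:R = (odd n)%:R :> 'F_2.
Proof. by rewrite -(@Fp_nat_mod 2 isT n) modn2. Qed.

Lemma det_complete n :
  \det (\matrix_(i < n, j < n) (i != j)%:R : 'M['F_2]_n) = (~~ odd n)%:R.
Proof.
set M := \matrix_(_, _) _.
have eM : M = const_mx 1 - 1%:M.
  by apply/matrixP => i j; rewrite !mxE; case: eqP; rewrite ?subrr ?subr0.
have JJ m : (const_mx 1 : 'M_n) *m const_mx 1 = const_mx n%:R :> 'M['F_2]_(n, m).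
  apply/matrixP => i j; rewrite !mxE -[n in RHS]card_ord -sumr_const.
  by apply: eq_bigr => k _; rewrite !mxE mulr1.
have [on|en] := boolP (odd n); last first.
  have MM : M *m M = 1%:M.
    rewrite eM mulmxBl mulmxBr mul1mx mulmx1 JJ natr_F2 (negPf en).
    by apply/matrixP => i j; rewrite !mxE; case: (i == j); apply: val_inj.
  have := congr1 determinant MM; rewrite det_mulmx det1; move: (\det M).
  by case=> -[|[|//]] i //= _; apply: val_inj.
have n0 : (0 < n)%N by case: n on {M eM JJ}.
have Mv : M *m (const_mx 1 : 'cV_n) = 0.
  rewrite eM mulmxBl mul1mx JJ natr_F2 on; apply/matrixP => i j.
  by rewrite !mxE subrr.
have := congr1 (mulmx (\adj M)) Mv; rewrite mulmxA mul_adj_mx mulmx0 mul_scalar_mx.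
by move/matrixP/(_ (Ordinal n0) 0); rewrite !mxE mulr1.
Qed.

Lemma sqdet_complete (T : finType) :
  sqdet (@digraph_matrix (Structure (@complete T))) = (~~ odd #|T|)%:R.
Proof.
rewrite -det_complete /sqdet; congr determinant; apply/matrixP => i j.
by rewrite !mxE /digraph_matrix /edge /complete /= (inj_eq enum_val_inj).
Qed.

End Determinant.

Theorem mainTheorem9 :
  ~ CPTime (fun G : structure digraph_voc =>
              sqdet (@digraph_matrix G) = 1%R :> 'F_2).
Proof.
case=> P [p [q /decides_within_agree[N hN]]].
have := hN 'I_N (@complete _) (@complete _); rewrite card_ord leqnn => /(_ isT)[].
- by move=> g R a; apply: complete_map; apply: perm_inj.
- by move=> R a; apply: complete_map; apply: Some_inj.
rewrite !sqdet_complete card_option card_ord /= negbK.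
by case: (odd N) => /= h1 h2; [have := h2 erefl | have := h1 erefl].
Qed.
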